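(* Let $n\ge 2$, fix a lattice $\mathbb{Z}+\mathbb{Z}\tau$ ($\operatorname{Im}\tau>0$) with Weierstrass function $\wp$, and fix $\lambda_1,\dots,\lambda_n\in\mathbb{C}$ with $\lambda_i-\lambda_j\notin\mathbb{Z}+\mathbb{Z}\tau$ for $i\ne j$. Let $\mathcal{A}$ be the algebra described in the context, with Dunkl elements $\theta_i=\sum_{j\ne i}[ij]$ (which commute pairwise). Then for every subset $I\subset\{1,\dots,n\}$ and every integer $k\ge 0$, one has in $\mathcal{A}$ \[ E_k(\theta_i\mid i\in I)=\sum_{l=0}^{[k/2]}\ \sum_{I_0\subset I,\ \#I_0=2l}\phi(I_0)\sum_{( * )}[a_1\,b_1][a_2\,b_2]\cdots[a_{k-2l}\,b_{k-2l}], \] where the inner sum $( * )$ runs over all sequences $(a_1,b_1),\dots,(a_{k-2l},b_{k-2l})$ such that $a_i\in I\setminus I_0$, $b_i\notin I$, $a_1,\dots,a_{k-2l}$ are pairwise distinct, and $b_1\le b_2\le\cdots\le b_{k-2l}$.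
   Context: Write $x_1,\dots,x_n$ for the coordinates on $\mathbb{C}^n$, $x_{ij}=x_i-x_j$, $\lambda_{ij}=\lambda_i-\lambda_j$, and let $\mathcal{M}$ be the field of meromorphic functions on $\mathbb{C}^n$; for $i\ne j$ let $s_{ij}$ act on $\mathcal{M}$ by $(s_{ij}f)(x)=f(x')$ where $x'$ is $x$ with coordinates $x_i,x_j$ interchanged. The algebra $\mathcal{A}$ (denoted $\tilde{\mathcal{E}}_n(\psi_{ij})$ in the paper, for $\psi_{ij}(z)=A/z^2-(\wp(z)-\wp(\lambda_i-\lambda_j))$) is the $\mathbb{C}$-algebra generated by $\mathcal{M}$ (with its multiplication) and symbols $[ij]$, $1\le i\ne j\le n$, with $[ji]=-[ij]$, subject to the relations: (i) $[ij]^2=\wp(\lambda_{ij})-\wp(x_{ij})$; (ii) $[ij][kl]=[kl][ij]$ if $\{i,j\}\cap\{k,l\}=\emptyset$; (iii) $[ij][jk]+[jk][ki]+[ki][ij]=0$ for distinct $i,j,k$; (iv) $[ij]f=(s_{ij}f)[ij]$ for $f\in\mathcal{M}$. For $I_0\subset\{1,\dots,n\}$ with $\#I_0=2m$, $\phi(I_0)\in\mathcal{M}$ is $\sum\prod_{i=1}^m\wp(x_{a_ib_i})$, the sum over all ways of writing $I_0=\{a_1,\dots,a_m,b_1,\dots,b_m\}$ with $a_1<\cdots<a_m$ and $a_i<b_i$ (i.e. over perfect matchings of $I_0$); $\phi(\emptyset)=1$. For a finite set $I$ of indices, the deformed elementary symmetric polynomials $E_k(I)=E_k(X_i\mid i\in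 I)$ in commuting variables $X_i$ are defined by $E_0(I)=1$, $E_k(I)=0$ for $k<0$, $E_k(\emptyset)=0$ for $k>0$, and for $j\notin I$: $E_k(I\cup\{j\})=E_k(I)+E_{k-1}(I)X_j+\sum_{i\in I}\wp(\lambda_{ij})E_{k-2}(I\setminus\{i\})$. $E_k(\theta_i\mid i\in I)$ denotes the substitution $X_i=\theta_i$. *)

(* Defs.v *)
From HB Require Import structures.
From mathcomp Require Import all_boot all_order all_algebra.
From mathcomp Require Import complex perm.
From mathcomp Require Import all_classical all_reals all_analysis.
Set Implicit Arguments. Unset Strict Implicit. Unset Printing Implicit Defensive.
Import Order.TTheory GRing.Theory Num.Theory.
Import numFieldNormedType.Exports.
Local Open Scope ring_scope.
Local Open Scope classical_set_scope.

Section Defs.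
Variable R : realType.

Definition Cx : Type := (R[i])^o.

Definition Cn (n : nat) : Type := 'rV[Cx]_n.

Definition in_lattice (tau z : Cx) : Prop :=
  exists m k : int, z = m%:~R + k%:~R * tau.

(* Square partial sums of the Weierstrass series
   sum_{w in L, w <> 0} (1/(z-w)^2 - 1/w^2), over w = m + k tau, |m|,|k| <= N. *)
Definition wp_partial (tau z : Cx) (N : nat) : Cx :=
  \sum_(a < (N + N).+1) \sum_(b < (N + N).+1)
    (if ((a : nat) != N) || ((b : nat) != N) then
       let w : Cx := ((a%:R - N%:R) + (b%:R - N%:R) * tau) in
       ((z - w) ^- 2 - w ^- 2)
     else 0).

(* Weierstrass wp-function of the lattice Z + Z tau:
   wp(z) = 1/z^2 + sum_{w in L\{0}} (1/(z-w)^2 - 1/w^2)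
   (the series converges absolutely for z not in L; its value at lattice
   points is an irrelevant junk value). *)
Definition wp (tau z : Cx) : Cx := z ^- 2 + limn (wp_partial tau z).

Definition holomorphic_on (n : nat) (U : set (Cn n)) (f : Cn n -> Cx) : Prop :=
  open U /\ forall x, U x -> differentiable f x.

(* A (representative of a) meromorphic function on C^n: locally, on a
   connected open neighbourhood U of every point, f = g/h with g, h
   holomorphic on U and h not identically zero on U (f is required to agree
   with g/h wherever h does not vanish; values on the polar/indeterminacy
   set are irrelevant). *)
Definition meromorphic (n : nat) (f : Cn n -> Cx) : Prop :=
  forall p : Cn n, exists U : set (Cn n), exists g h : Cn n -> Cx,
    [/\ U p /\ connected U, holomorphic_on U g, holomorphic_on U h,
        (exists z, U z /\ h z != 0) &
        forall z, U z -> h z != 0 -> f z = g z / h z].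

(* Two representatives define the same meromorphic function iff they agree
   on a dense subset of C^n. *)
Definition mero_eq (n : nat) (f g : Cn n -> Cx) : Prop :=
  dense [set z | f z = g z].

Definition swapf (n : nat) (i j : 'I_n) (f : Cn n -> Cx) : Cn n -> Cx :=
  fun x => f (\row_k x ord0 (tperm i j k)).

(* phi(I0) = sum over perfect matchings {a_1<b_1},...,{a_m<b_m} of I0 with
   a_1 < ... < a_m of prod_i wp(x_{a_i} - x_{b_i}); here m = #I0 / 2. *)
Definition is_matching (n : nat) (I0 : {set 'I_n}) (m : nat)
    (ab : {ffun 'I_m -> 'I_n * 'I_n}) : bool :=
  [&& [forall t, ((ab t).1 < (ab t).2)%N],
      [forall t1 : 'I_m, forall t2 : 'I_m, ((t1 < t2)%N ==> ((ab t1).1 < (ab t2).1)%N)],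
      (2 * m == #|I0|)%N &
      I0 == [set (ab t).1 | t in 'I_m] :|: [set (ab t).2 | t in 'I_m]].

Definition phi (n : nat) (tau : Cx) (I0 : {set 'I_n}) : Cn n -> Cx :=
  fun x => \sum_(ab : {ffun 'I_(#|I0| %/ 2) -> 'I_n * 'I_n} | is_matching I0 ab)
             \prod_(t < #|I0| %/ 2) wp tau (x ord0 (ab t).1 - x ord0 (ab t).2).

End Defs.

(* Deformed elementary symmetric polynomials E_k, evaluated at X_i := X i
   in a ring A, with the deformation constants wp(lambda_i - lambda_j)
   given by c i j.  Following the recursive definition
     E_k(I u {j}) = E_k(I) + E_{k-1}(I) X_j + sum_{i in I} c i j E_{k-2}(I\{i}),
   the set is given as a duplicate-free list (head = the element j added last);
   [fuel] is a recursion bound, used with fuel = size of the list. *)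
Fixpoint Edef (A : pzRingType) (n : nat) (X : 'I_n -> A) (c : 'I_n -> 'I_n -> A)
    (fuel : nat) (s : seq 'I_n) (k : nat) : A :=
  match fuel, s with
  | fuel'.+1, j :: s' =>
      Edef X c fuel' s' k
      + (if k is k'.+1 then Edef X c fuel' s' k' * X j else 0)
      + (if k is k''.+2 then \sum_(i <- s') c i j * Edef X c fuel' (rem i s') k''
         else 0)
  | _, _ => (k == 0)%:R
  end.

Definition Eset (A : pzRingType) (n : nat) (X : 'I_n -> A) (c : 'I_n -> 'I_n -> A)
    (I : {set 'I_n}) (k : nat) : A :=
  Edef X c #|I| (enum I) k.

Definition dunkl (A : pzRingType) (n : nat) (br : 'I_n -> 'I_n -> A) (i : 'I_n) : A :=
  \sum_(j | j != i) br i j.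

Definition star_seq (n : nat) (I I0 : {set 'I_n}) (m : nat)
    (ab : {ffun 'I_m -> 'I_n * 'I_n}) : bool :=
  [&& [forall t, (ab t).1 \in I :\: I0],
      [forall t, (ab t).2 \notin I],
      [forall t1 : 'I_m, forall t2 : 'I_m, ((ab t1).1 == (ab t2).1) ==> (t1 == t2)] &
      [forall t1 : 'I_m, forall t2 : 'I_m, ((t1 <= t2)%N ==> ((ab t1).2 <= (ab t2).2)%N)]].

(* Main.v *)
Require Import Defs.
From HB Require Import structures.
From mathcomp Require Import all_boot all_order all_algebra.
From mathcomp Require Import complex perm ring lra zify.
Import Order.TTheory GRing.Theory Num.Theory.
Local Open Scope ring_scope.
Set Implicit Arguments. Unset Strict Implicit. Unset Printing Implicit Defensive.

(** Fix a letter j outside I, put B = ~: (j |: I), and let K_B(S) be the sum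
    over U \subset S of phi(U) times the products [a_1 b_1]...[a_m b_m], with
    {a_t} = S :\: U and b_1 <= ... <= b_m in B.  The right-hand side of the
    theorem is the sum of K_{~: I}(S) over the k-subsets S of I, so the
    recursion defining E_k follows from two identities, for S \subset I:
      K_{B+j}(S)  = K_B(S) + sum_{i in S} K_{B+j}(S\i) [ij],
      K_B(S+j)    = K_{B+j}(S) (sum_{b in B} [jb] + sum_{i in S} [ji])
                    + sum_{i in S} wp(lambda_ij) K_{B+j+i}(S\i).
    The first is immediate.  In the second the repeated letter in a product
    ...[ij]...[ij] is removed by the cyclic relation
      sum_{i in T} [ij] G_j(T\i) [ij] = sum_{i in T} wp(lambda_ij) G_i(T\i)
                                        - (wp(x_ij) if T = {i}),
    where G_b(T) sums [a_1 b]...[a_m b] over the orderings of T; the terms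
    wp(x_ij) so produced are absorbed by the expansion of phi along a pivot.

    To be allowed to use the additivity and multiplicativity of iota one needs
    x |-> wp(x_i - x_j) to be meromorphic: near a given point wp is the sum of
    finitely many terms of its series and of a tail, whose terms have Taylor
    remainders bounded by C |h|^2 / |w|^3 and which is therefore holomorphic. *)

(** * Sums over subsets *)

(** No single S produces theta_j. The second identity gives only the brackets of theta_j indexed by
    B and S; the missing [ji], with i in I \ S, come from the first identity applied to S+i, which
    contains K_{B+j}(S)[ij] = -K_{B+j}(S)[ji]. The recursion for E_k therefore appears only after
    summation over all subsets of a given size. In the theorem the b_t follow the order of the
    indices, while the recursion puts the new letter j in front of a list. Brackets without a common
    index commute, and the a_t are distinct from each other and from all letters, so the order of
    the list is immaterial: K_B is defined for lists B and shown to be invariant under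
    permutation. *)

Section SubsetSums.
Variables (I : finType) (A : nmodType).
Implicit Types (S T U V W : {set I}).

Lemma sum_setD1C T (F : I -> I -> A) :
  \sum_(i in T) \sum_(k in T :\ i) F i k = \sum_(k in T) \sum_(i in T :\ k) F i k.
Proof.
rewrite (exchange_big_dep (mem T)) /=; last by move=> i k _; rewrite inE => /andP[].
apply: eq_bigr => k kT; apply: eq_bigl => i.
by rewrite !inE kT andbT eq_sym andbC.
Qed.

(** This and [sum_subset_notin] do the reindexing each time one index is peeled off a word or a
    matching. *)
Lemma sum_subset_in T (F : I -> {set I} -> A) :
  \sum_(U : {set I} | U \subset T) \sum_(i in U) F i U =
  \sum_(i in T) \sum_(U : {set I} | U \subset T :\ i) F i (i |: U).
Proof.
rewrite (exchange_big_dep (mem T)) /=; last by move=> U i /subsetP; apply.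
apply: eq_bigr => i iT.
rewrite (reindex_onto (fun U => i |: U) (fun U => U :\ i)) /=; last first.
  by move=> U /andP[_ iU]; rewrite setD1K.
apply: eq_bigl => U; rewrite setU11 andbT subsetD1 subUset sub1set iT /=.
case iU: (i \in U); last by rewrite setU1K ?iU // eqxx !andbT.
rewrite /= andbF; apply/negbTE; rewrite negb_and; apply/orP; right.
by apply/eqP => E; move: iU; rewrite -E !inE eqxx.
Qed.

Lemma sum_subset_notin T (F : I -> {set I} -> A) :
  \sum_(U : {set I} | U \subset T) \sum_(i in T :\: U) F i U =
  \sum_(i in T) \sum_(U : {set I} | U \subset T :\ i) F i U.
Proof.
rewrite (exchange_big_dep (mem T)) /=; last by move=> U i _; rewrite inE => /andP[].
apply: eq_bigr => i iT; apply: eq_bigl => U.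
by rewrite !inE iT andbT subsetD1.
Qed.

Lemma sum_subsetU1 a T (F : {set I} -> A) : a \notin T ->
  \sum_(U : {set I} | U \subset a |: T) F U =
  \sum_(U : {set I} | U \subset T) F U + \sum_(U : {set I} | U \subset T) F (a |: U).
Proof.
move=> aT; rewrite (bigID (fun U => a \in U)) /= addrC; congr (_ + _).
  apply: eq_bigl => U; rewrite -subsetD1 setU1K //.
rewrite (reindex_onto (fun U => a |: U) (fun U => U :\ a)) /=; last first.
  by move=> U /andP[_ iU]; rewrite setD1K.
apply: eq_bigl => U; rewrite setU11 andbT subUset sub1set setU11 /=.
apply/andP/idP => [[UT /eqP E]|UT].
  by rewrite -(setU1K aT) subsetD1 UT -E setD11.
split; first exact: subset_trans UT (subsetUr _ _).
by rewrite setU1K //; apply: contra aT; apply/subsetP.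
Qed.

Lemma sum_subsetC T (F : {set I} -> {set I} -> A) :
  \sum_(U : {set I} | U \subset T) F U (T :\: U) = \sum_(U : {set I} | U \subset T) F (T :\: U) U.
Proof.
have DK U : U \subset T -> T :\: (T :\: U) = U.
  by move=> UT; rewrite setDDr setDv set0U; apply/setIidPr.
rewrite (reindex_onto (fun U => T :\: U) (fun U => T :\: U)) //=.
apply: eq_big => [U|U /andP[_ /eqP ->] //].
rewrite subsetDl /=; apply/eqP/idP => [<-|/DK //]; exact: subsetDl.
Qed.

(** Both sides run over the splittings of [S] into three ordered blocks. This is the associativity
    used whenever nested words are regrouped. *)
Lemma sum_subsetA S (F : {set I} -> {set I} -> {set I} -> A) :
  \sum_(U : {set I} | U \subset S) \sum_(V : {set I} | V \subset U) F V (U :\: V) (S :\: U) =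
  \sum_(U : {set I} | U \subset S) \sum_(V : {set I} | V \subset S :\: U) F U V (S :\: U :\: V).
Proof.
rewrite (exchange_big_dep (fun V => V \subset S)) /=; last first.
  by move=> U V US VU; apply: subset_trans US.
apply: eq_bigr => V VS.
rewrite (reindex_onto (fun U => V :|: U) (fun U => U :\: V)) /=; last first.
  move=> U /andP[_ /subsetP VU]; apply/setP => x; rewrite !inE.
  by move/(_ x): VU; case: (x \in V) => //= ->.
apply: eq_big => [U|U /andP[_ /eqP E]].
  rewrite subUset VS /= subsetUl andbT subsetD.
  apply/andP/andP => [[US /eqP E]|[US dUV]]; split => //.
    by rewrite -E -setI_eq0; apply/eqP/setP => x; rewrite !inE; case: (x \in V); rewrite ?andbF.
  by rewrite setDUl setDv set0U; apply/eqP/setDidPl.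
by rewrite E setDUr; congr (F _ _ _); apply/setP => x; rewrite !inE; case: (x \in V); case: (x \in S); case: (x \in U).
Qed.
End SubsetSums.

(** * The bracket algebra *)

Section Brackets.
(* [P i j] and [c i j] stand for wp(x_i - x_j) and wp(lambda_i - lambda_j). *)
Variables (I : finType) (A : pzRingType) (br P c : I -> I -> A).
Implicit Types (S T U V W : {set I}) (i j k l a b d p : I).

Hypothesis brN : forall i j, i != j -> br j i = - br i j.
Hypothesis br2 : forall i j, i != j -> br i j * br i j = c i j - P i j.
Hypothesis brC : forall i j k l, i != j -> k != l ->
  [disjoint [set i; j] & [set k; l]] -> br i j * br k l = br k l * br i j.
Hypothesis br3 : forall i j k, i != j -> j != k -> k != i ->
  br i j * br j k + br j k * br k i + br k i * br i j = 0.
Hypothesis brP : forall i j k l, i != j -> k != l ->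
  br i j * P k l = P (tperm i j k) (tperm i j l) * br i j.
Hypothesis brc : forall i j k l, i != j -> br i j * c k l = c k l * br i j.
Hypothesis PC : forall i j, P i j = P j i.

Lemma br_comm i j k l : i != j -> k != l -> i != k -> i != l -> j != k -> j != l ->
  br i j * br k l = br k l * br i j.
Proof.
move=> ij kl ik il jk jl; apply: brC => //.
rewrite -setI_eq0; apply/eqP/setP => x; rewrite !inE.
by case: eqP => [->|_]; [rewrite (negbTE ik) (negbTE il)|case: eqP => // ->; rewrite (negbTE jk) (negbTE jl)].
Qed.

(** Relation (iii) for [p], [j], [a], with the signs arranged so that [br p j] either moves to the
    right or turns into [br p a], which no longer involves [j]. *)
Lemma br_exchange p a j : p != a -> a != j -> p != j ->
  br p j * br a j = br a p * br p j + br a j * br p a.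
Proof.
move=> pa aj pj; have ja : j != a by rewrite eq_sym.
have ap : a != p by rewrite eq_sym.
have := br3 pj ja ap; rewrite (brN aj) (brN ap) !mulrN mulNr.
by move/eqP; rewrite -addrA addrC subr_eq0 => /eqP <-; rewrite addrC.
Qed.

(** * Words with a common second index, and the cyclic relation *)

Fixpoint word_rec m b T : A :=
  if m is m'.+1 then \sum_(i in T) br i b * word_rec m' b (T :\ i) else 1.
(* The sum G_b(T) of [a_1 b]...[a_m b] over all orderings a_1,...,a_m of T. *)
Definition word b T : A := word_rec #|T| b T.

Lemma wordE b T :
  word b T = (T == set0)%:R + \sum_(i in T) br i b * word b (T :\ i).
Proof.
case: (set_0Vmem T) => [->|[x xT]].
  by rewrite eqxx /word cards0 /= big_set0 addr0.
have /negbTE -> : T != set0 by apply/set0Pn; exists x.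
rewrite add0r /word (cardsD1 x) xT /=; apply: eq_bigr => i iT.
by have := cardsD1 i T; rewrite iT (cardsD1 x T) xT !add1n => -[->].
Qed.

Lemma card_set_ind (Q : {set I} -> Prop) :
  (forall T, (forall U, (#|U| < #|T|)%N -> Q U) -> Q T) -> forall T, Q T.
Proof.
move=> H T; move: {2}#|T|.+1 (ltnSn #|T|) => m; elim: m T => // m IH T.
rewrite ltnS => Tm; apply: H => U UT; apply: IH; exact: leq_trans Tm.
Qed.

Lemma cardsD1_lt i T : i \in T -> (#|T :\ i| < #|T|)%N.
Proof. by move=> iT; rewrite (cardsD1 i T) iT. Qed.

Lemma setD11C i k T : T :\ i :\ k = T :\ k :\ i.
Proof. by rewrite !setDDl setUC. Qed.

Lemma setD1D i T U : (T :\ i) :\: U = (T :\: U) :\ i.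
Proof. by rewrite !setDDl setUC. Qed.

Lemma setD1D' i T U : T :\: U :\ i = T :\ i :\: U.
Proof. by rewrite setD1D. Qed.

Lemma wordEr b T :
  word b T = (T == set0)%:R + \sum_(i in T) word b (T :\ i) * br i b.
Proof.
elim/card_set_ind: T => T IH; rewrite wordE; congr (_ + _).
transitivity (\sum_(i in T) (br i b * (T :\ i == set0)%:R +
   \sum_(k in T :\ i) br i b * (word b (T :\ i :\ k) * br k b))).
  by apply: eq_bigr => i iT; rewrite IH ?cardsD1_lt // mulrDr mulr_sumr.
rewrite big_split /= sum_setD1C -big_split /=; apply: eq_bigr => i iT.
rewrite [in RHS]wordE mulrDl mulr_suml; congr (_ + _).
  by case: eqP; rewrite ?mulr0 ?mul0r ?mulr1 ?mul1r.
by apply: eq_bigr => k kT; rewrite mulrA setD11C.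
Qed.

Lemma word_comm x b T :
  (forall i, i \in T -> x * br i b = br i b * x) -> x * word b T = word b T * x.
Proof.
elim/card_set_ind: T => T IH H; rewrite wordE mulrDr mulrDl mulr_sumr mulr_suml; congr (_ + _).
  by case: eqP; rewrite ?mulr0 ?mul0r ?mulr1 ?mul1r.
apply: eq_bigr => i iT; rewrite mulrA H // -!mulrA IH ?cardsD1_lt // => k.
by rewrite inE => /andP[_]; apply: H.
Qed.

Lemma br_word_comm p a b T : p != a -> p \notin T -> a \notin T -> b \notin T ->
  p != b -> a != b -> br p a * word b T = word b T * br p a.
Proof.
move=> pa pT aT bT pb ab; apply: word_comm => i iT.
have N x : x \notin T -> x != i by move=> xT; apply: contraNneq xT => ->.
by apply: br_comm; rewrite ?N // eq_sym N.
Qed.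

Lemma word_P j T k l : k != l -> j \notin T -> k \notin T -> l \notin T ->
  j != k -> j != l -> P k l * word j T = word j T * P k l.
Proof.
move=> kl jT kT lT jk jl; apply: word_comm => i iT.
have N x : x \notin T -> i != x by move=> xT; apply: contraNneq xT => <-.
by rewrite brP ?N // !tpermD // ?N // eq_sym.
Qed.

Lemma word_c j T k l : j \notin T -> c k l * word j T = word j T * c k l.
Proof.
move=> jT; apply: word_comm => i iT; rewrite brc //.
by apply: contraNneq jT => <-.
Qed.

(** Cut each ordering of [p |: S] at [p]; the elements before it form [U]. *)
Lemma wordU1 p b S : p \notin S -> b \notin S -> p != b ->
  word b (p |: S) = \sum_(U : {set I} | U \subset S) word b U * br p b * word b (S :\: U).
Proof.
elim/card_set_ind: S => S IH pS bS pb; rewrite wordE.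
have /negbTE -> : p |: S != set0 by apply/set0Pn; exists p; rewrite setU11.
rewrite add0r big_setU1 //= setU1K //.
under [RHS]eq_bigr => U _ do rewrite wordE 2!mulrDl 2!mulr_suml.
rewrite big_split /=; congr (_ + _).
  rewrite (bigD1 set0) ?sub0set //= eqxx mul1r setD0 big1 ?addr0 // => U /andP[_ /negbTE ->].
  by rewrite !mul0r.
rewrite sum_subset_in; apply: eq_bigr => i iS.
have ip : i != p by apply: contraNneq pS => <-.
have -> : (p |: S) :\ i = p |: (S :\ i).
  by apply/setP => x; rewrite !inE; case: eqP => [->|//]; rewrite (negbTE ip).
rewrite IH ?cardsD1_lt // ?inE ?(negbTE pS) ?(negbTE bS) ?andbF // mulr_sumr.
apply: eq_bigr => U; rewrite subsetD1 => /andP[US iU].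
by rewrite setU1K // !mulrA setDDl.
Qed.

(** Apply [br_exchange] to [br p j] and the first letter of the word; [br p a] then commutes past
    the remaining letters. *)
Lemma br_word_step p j W : p \notin W -> j \notin W -> p != j ->
  br p j * word j W = (W == set0)%:R * br p j
    + \sum_(a in W) br a p * (br p j * word j (W :\ a))
    + \sum_(a in W) br a j * word j (W :\ a) * br p a.
Proof.
move=> pW jW pj; rewrite wordE mulrDr mulr_sumr -addrA; congr (_ + _).
  by case: eqP; rewrite ?mulr0 ?mul0r ?mulr1 ?mul1r.
rewrite -big_split /=; apply: eq_bigr => a aW.
have pa : p != a by apply: contraNneq pW => ->.
have aj : a != j by apply: contraNneq jW => <-.
rewrite !mulrA br_exchange // mulrDl; congr (_ + _).
rewrite -!mulrA br_word_comm // ?inE ?eqxx ?(negbTE pW) ?(negbTE jW) ?andbF //.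
Qed.

(** Cut at [p], apply [br_word_step] to the part that starts there, and glue the pieces again with
    [wordU1]: [br a p] commutes to the front, and the pieces around [br a i] recombine to the full
    [word i U] for every [a]. *)
Lemma word_insert p i U : p \notin U -> i \notin U -> p != i ->
  word i (p |: U) = word i U * br p i + \sum_(a in U) br a p * word i (p |: (U :\ a))
    + \sum_(a in U) word i U * br p a.
Proof.
move=> pU iU pi; rewrite wordU1 //.
under eq_bigr => V VU.
  have [pV iV] : p \notin U :\: V /\ i \notin U :\: V by rewrite !inE (negbTE pU) (negbTE iU) !andbF.
  rewrite -mulrA br_word_step // !mulrDr 2!mulr_sumr; over.
rewrite !big_split /= -!addrA; congr (_ + _).
  rewrite (bigD1 U) //= setDv eqxx mul1r big1 ?addr0 // => V /andP[VU VnU].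
  by move: VnU; rewrite setD_eq0 eqEsubset VU /= => /negbTE ->; rewrite mul0r mulr0.
congr (_ + _); rewrite sum_subset_notin; apply: eq_bigr => a aU.
- have ap : a != p by apply: contraNneq pU => <-.
  have ai : a != i by apply: contraNneq iU => <-.
  rewrite wordU1 ?inE ?(negbTE pU) ?(negbTE iU) ?andbF // mulr_sumr.
  apply: eq_bigr => V; rewrite subsetD1 => /andP[VU aV].
  have pV : p \notin V by apply: contra pU; apply/subsetP.
  have iV : i \notin V by apply: contra iU; apply/subsetP.
  by rewrite !mulrA -(br_word_comm ap) // setD1D.
- have ai : a != i by apply: contraNneq iU => <-.
  rewrite -[in RHS](setD1K aU) wordU1 ?inE ?eqxx ?(negbTE iU) ?andbF // mulr_suml.
  by apply: eq_bigr => V; rewrite subsetD1 => /andP[VU aV]; rewrite !mulrA setD1D.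
Qed.


Lemma notinD1 x i T : x \notin T -> x \notin T :\ i.
Proof. by move=> xT; rewrite inE (negbTE xT) andbF. Qed.

Lemma notinD x T U : x \notin T -> x \notin T :\: U.
Proof. by move=> xT; rewrite inE (negbTE xT) andbF. Qed.

Lemma notin_sub x T U : U \subset T -> x \notin T -> x \notin U.
Proof. by move=> /subsetP UT; apply/contra/UT. Qed.

Lemma neq_notin x i T : i \in T -> x \notin T -> x != i.
Proof. by move=> iT; apply: contraNneq => ->. Qed.

Lemma sum_subset_setD0 S (F : {set I} -> A) :
  \sum_(U : {set I} | U \subset S) (S :\: U == set0)%:R * F U = F S.
Proof.
rewrite (bigD1 S) //= setDv eqxx mul1r big1 ?addr0 // => U /andP[US UnS].
by move: UnS; rewrite setD_eq0 eqEsubset US /= => /negbTE ->; rewrite mul0r.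
Qed.

Lemma delta_comm (e : bool) (x : A) : x * e%:R = e%:R * x.
Proof. by case: e; rewrite ?mulr1 ?mul1r ?mulr0 ?mul0r. Qed.

(** On the left [j] is a first index, on the right it is the common second index of a word. In
    [word_insert] with pivot [j], the terms starting with [br a j] are treated by induction, and
    [br a j] commutes past [word b U] to become the first letter of a word in [j]. *)
Lemma word_insert_conv b j T : b \notin T -> j \notin T -> b != j ->
  word b (j |: T) = \sum_(U : {set I} | U \subset T)
    word b U * word j (T :\: U) * (br j b + \sum_(i in U) br j i).
Proof.
elim/card_set_ind: T => T IH bT jT bj; rewrite word_insert 1?eq_sym //.
under [RHS]eq_bigr => U UT do rewrite (wordE j) [word b U * (_ + _)]mulrDr mulrDl delta_comm -mulrA.
rewrite big_split /= sum_subset_setD0 mulrDr mulr_sumr -!addrA; congr (_ + _).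
rewrite addrC; congr (_ + _).
under [RHS]eq_bigr => U UT do rewrite mulr_sumr mulr_suml.
rewrite sum_subset_notin; apply: eq_bigr => a aT.
rewrite IH ?cardsD1_lt ?notinD1 // mulr_sumr; apply: eq_bigr => U.
rewrite subsetD1 => /andP[UT aU].
have aj := neq_notin aT jT; have ab := neq_notin aT bT; rewrite eq_sym in aj; rewrite eq_sym in ab.
have jb : j != b by rewrite eq_sym.
by rewrite !mulrA (br_word_comm aj) ?aU ?(notin_sub UT) // setD1D.
Qed.

(* The left-hand side of the cyclic relation. *)
Definition wordsq j T : A := \sum_(i in T) br i j * word j (T :\ i) * br i j.

(** Apart from the start value, every term is the same sum over a smaller set times a bracket free
    of [j]. The summand of the pivot is expanded by [br_word_step], the others by [word_insert]. *)
Lemma wordsqE p j S : p \notin S -> j \notin S -> p != j ->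
  wordsq j (p |: S) = (S == set0)%:R * (c p j - P p j)
    + \sum_(a in S) br a p * wordsq j (p |: (S :\ a))
    + \sum_(a in S) wordsq j S * br p a.
Proof.
move=> pS jS pj.
have U1D a : a \in S -> (p |: S) :\ a = p |: (S :\ a).
  move=> aS; apply/setP => x; rewrite !inE.
  by case: (x =P p) => [->|_]; rewrite ?(neq_notin aS pS).
have sqU1 W : p \notin W -> W \subset S ->
    wordsq j (p |: W) = br p j * word j W * br p j +
      \sum_(i in W) br i j * word j (p |: (W :\ i)) * br i j.
  move=> pW WS; rewrite /wordsq big_setU1 //= setU1K //; congr (_ + _).
  apply: eq_bigr => i iW; congr (_ * word j _ * _).
  by apply/setP => x; rewrite !inE; case: (x =P p) => [->|_]; rewrite ?(neq_notin iW pW).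
rewrite sqU1 // br_word_step // 2!mulrDl -mulrA br2 // -!addrA; congr (_ + _).
have -> : \sum_(a in S) br a p * wordsq j (p |: (S :\ a)) =
    (\sum_(a in S) br a p * (br p j * word j (S :\ a))) * br p j +
    \sum_(a in S) \sum_(d in S :\ a) br a p * (br d j * word j (p |: (S :\ a :\ d)) * br d j).
  rewrite mulr_suml -big_split /=; apply: eq_bigr => a aS.
  by rewrite sqU1 ?notinD1 ?subD1set // mulrDr mulr_sumr !mulrA.
rewrite -!addrA; congr (_ + _); rewrite mulr_suml.
transitivity (\sum_(a in S) br a j * word j (S :\ a) * br p a * br p j
   + \sum_(a in S) (br a j * word j (S :\ a) * (br a p * br p j + br a j * br p a)
      + (\sum_(d in S :\ a) br d p * (br a j * word j (p |: (S :\ a :\ d)) * br a j)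
      + \sum_(d in S :\ a) (br a j * word j (S :\ a) * br a j) * br p d))).
  congr (_ + _); apply: eq_bigr => a aS.
  have pa := neq_notin aS pS; have ja := neq_notin aS jS.
  have ap : a != p by rewrite eq_sym.
  have aj : a != j by rewrite eq_sym.
  have jp : j != p by rewrite eq_sym.
  have comm d : d != a -> d \in S -> br a j * br d p = br d p * br a j /\ br p d * br a j = br a j * br p d.
    move=> da dS; have pd := neq_notin dS pS; have jd := neq_notin dS jS.
    by split; apply: br_comm; rewrite // eq_sym.
  rewrite word_insert ?notinD1 // -addrA mulrDr mulrDl -!mulrA -br_exchange //; congr (_ + _).
  rewrite mulrDl mulrDr !mulr_suml !mulr_sumr; congr (_ + _); apply: eq_bigr => d.
    rewrite in_setD1 => /andP[da dS]; rewrite !mulrA.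
    by case: (comm d da dS) => -> _.
  rewrite in_setD1 => /andP[da dS]; rewrite -!mulrA.
  by case: (comm d da dS) => _ ->.
rewrite -big_split /=.
(* [br p a * br p j] and [br a p * br p j] cancel; the other half of the exchange, ending in
   [br a j * br p a], is the term [d = a] that the last sum was missing. *)
transitivity (\sum_(a in S) (\sum_(d in S :\ a) br d p * (br a j * word j (p |: (S :\ a :\ d)) * br a j)
    + \sum_(d in S) (br a j * word j (S :\ a) * br a j) * br p d)).
  apply: eq_bigr => a aS; rewrite [X in _ = _ + X](big_setD1 a) //=.
  have pa := neq_notin aS pS.
  rewrite [br p a]brN 1?eq_sym // !mulrN mulNr mulrDr !mulrA [RHS]addrCA !addrA.
  by rewrite addNr add0r mulrN !mulrA.
rewrite big_split /= sum_setD1C; congr (_ + _).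
  by apply: eq_bigr => a aS; apply: eq_bigr => d dS; rewrite setD11C.
by rewrite exchange_big /=; apply: eq_bigr => a aS; rewrite mulr_suml.
Qed.

(** Induction on [#|T|] with a pivot [p]: by [word_insert], the right-hand side obeys the recursion
    of [wordsqE]. *)
Lemma wordsq_sum j T : j \notin T -> wordsq j T =
  \sum_(i in T) c i j * word i (T :\ i) - \sum_(i in T) (T :\ i == set0)%:R * P i j.
Proof.
elim/card_set_ind: T => T IH jT.
have [T0|[p pT]] := set_0Vmem T.
  by rewrite /wordsq T0 !big_set0 subr0.
have pj : p != j by rewrite eq_sym (neq_notin pT).
have TE := setD1K pT; move: (T :\ p) TE (setD11 p T) (cardsD1_lt pT) => S TE pS cS.
have {pS} pS : p \notin S by rewrite pS.
rewrite -TE; have jS : j \notin S by apply: contra jT; rewrite -TE inE orbC => ->.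
have neq i : i \in S -> (i != p) * (i != j).
  by move=> iS; split; rewrite eq_sym (neq_notin iS).
have U1D i : i \in S -> (p |: S) :\ i = p |: (S :\ i).
  move=> iS; apply/setP => x; rewrite !inE.
  by case: (x =P p) => [->|_]; rewrite ?(neq_notin iS pS).
have U1n0 (U : {set I}) : (p |: U == set0) = false by apply/set0Pn; exists p; rewrite setU11.
rewrite wordsqE // !big_setU1 //= setU1K //.
have -> : \sum_(i in S) ((p |: S) :\ i == set0)%:R * P i j = 0.
  by rewrite big1 // => i iS; rewrite U1D // U1n0 mul0r.
rewrite addr0.
have IHa a : a \in S -> wordsq j (p |: (S :\ a)) =
    c p j * word p (S :\ a) + \sum_(i in S :\ a) c i j * word i (p |: (S :\ a :\ i))
    - (S :\ a == set0)%:R * P p j.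
  move=> aS; rewrite IH.
  - rewrite !big_setU1 ?notinD1 //= setU1K ?notinD1 // [X in _ - (_ + X)]big1 ?addr0.
      congr (_ + _ - _); apply: eq_bigr => i; rewrite in_setD1 => /andP[ia iS].
      congr (_ * word _ _); apply/setP => x; rewrite !inE.
      by case: (x =P p) => [->|_]; rewrite ?(neq_notin iS pS).
    move=> i; rewrite in_setD1 => /andP[ia iS]; rewrite (_ : _ :\ i = p |: (S :\ a :\ i)) ?U1n0 ?mul0r //.
    apply/setP => x; rewrite !inE.
    by case: (x =P p) => [->|_]; rewrite ?(neq_notin iS pS).
  - by rewrite -TE !cardsU1 notinD1 // pS !add1n ltnS cardsD1_lt.
  - by rewrite !inE eq_sym (negbTE pj) (negbTE jS) andbF.
under eq_bigr => a aS do rewrite IHa // mulrBr mulrDr mulr_sumr.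
rewrite IH // sumrB big_split /=.
under [X in _ + X]eq_bigr => a aS do rewrite mulrBl !mulr_suml.
rewrite sumrB.
(* Only [S = [set i]] contributes. There [br i p] conjugates [P p j] into [P i j], so the two
   corrections left by the induction hypothesis cancel. *)
have -> : \sum_(a in S) \sum_(i in S) (S :\ i == set0)%:R * P i j * br p a =
   - \sum_(a in S) br a p * ((S :\ a == set0)%:R * P p j).
  rewrite exchange_big -sumrN /=; apply: eq_bigr => i iS.
  case: eqP => [E|_]; last first.
    by rewrite !mul0r mulr0 oppr0 big1 // => a _; rewrite !mul0r.
  have -> : S = [set i] by rewrite -(setD1K iS) E setU0.
  have [ip ij] := neq i iS.
  rewrite big_set1 !mul1r brP // tpermR tpermD ?(eq_sym j) //.
  by rewrite (brN ip) mulrN.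

have -> : \sum_(i in S) c i j * word i ((p |: S) :\ i) =
    \sum_(i in S) c i j * (word i (S :\ i) * br p i) +
    (\sum_(i in S) \sum_(a in S :\ i) c i j * (br a p * word i (p |: (S :\ i :\ a)))
    + \sum_(i in S) \sum_(a in S :\ i) c i j * (word i (S :\ i) * br p a)).
  rewrite -!big_split /=; apply: eq_bigr => i iS; have [ip ij] := neq i iS.
  rewrite U1D // word_insert ?setD11 ?notinD1 // 1?eq_sym //.
  by rewrite !mulrDr !mulr_sumr addrA.
have rearr (d e x y z w : A) : d - e + (x + y - z) + (w + z) = d + x + (y + w) - e.
  by rewrite [w + z]addrC addrA -[d - e + _ + z]addrA subrK -!addrA; congr (_ + _);
     rewrite addrC -!addrA.
rewrite opprK mulrBr rearr; congr (_ + _ - _).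
  rewrite (wordE p S) mulrDr delta_comm mulr_sumr; congr (_ + _).
  by apply: eq_bigr => a aS; rewrite !mulrA brc //; case: (neq a aS).
rewrite addrCA; congr (_ + _).
  rewrite sum_setD1C; apply: eq_bigr => i iS; apply: eq_bigr => a.
  rewrite in_setD1 => /andP[ai aS]; have [ap _] := neq a aS.
  by rewrite !mulrA brc // setD11C.
rewrite exchange_big /= -big_split /=; apply: eq_bigr => i iS.
by rewrite (big_setD1 i) //= !mulrA; congr (_ + _); apply: eq_bigr => a _; rewrite mulrA.
Qed.

(** Cut each ordering of [T] at the index [i] that is repeated: the letters after it, enclosed by
    two copies of [br i j], form a summand of [wordsq]. *)
Lemma word_derive j T : j \notin T ->
  \sum_(i in T) word j T * br i j =
  \sum_(U : {set I} | U \subset T) word j U * wordsq j (T :\: U).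
Proof.
move=> jT; under [RHS]eq_bigr => U _ do rewrite /wordsq mulr_sumr.
rewrite sum_subset_notin; apply: eq_bigr => i iT.
have ij : i != j by rewrite eq_sym (neq_notin iT).
rewrite -{1}(setD1K iT) wordU1 ?setD11 ?notinD1 // mulr_suml.
by apply: eq_bigr => U _; rewrite !mulrA setD1D.
Qed.

(** The correction [P i j] of [wordsq_sum] stands to the right of a word. Moved left past the last
    letter [br a j] it becomes [P a i], with both indices in [T]; in this form the expansion of phi
    can cancel it. *)
Lemma word_top j T : j \notin T ->
  \sum_(i in T) word j T * br i j =
  \sum_(i in T) c i j * (\sum_(U : {set I} | U \subset T :\ i) word j U * word i (T :\ i :\: U))
  - \sum_(i in T) (T :\ i == set0)%:R * P i j
  - \sum_(i in T) \sum_(a in T :\ i) P a i * (word j (T :\ i :\ a) * br i j).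
Proof.
move=> jT; rewrite word_derive //.
under eq_bigr => U UT do rewrite wordsq_sum ?notinD // mulrBr 2!mulr_sumr.
rewrite sumrB !sum_subset_notin -addrA -opprD; congr (_ - _).
  apply: eq_bigr => i iT; rewrite mulr_sumr; apply: eq_bigr => U.
  rewrite subsetD1 => /andP[UT iU].
  by rewrite mulrA -word_c ?(notin_sub UT) // setD1D mulrA.
rewrite [X in _ + X]sum_setD1C -big_split /=; apply: eq_bigr => i iT.
under eq_bigr => U UT do rewrite setD1D' mulrA delta_comm -mulrA.
rewrite sum_subset_setD0 wordEr mulrDl mulr_suml; congr (_ + _); apply: eq_bigr => a.
rewrite in_setD1 => /andP[ai aT].
have [ja ji] := (neq_notin aT jT, neq_notin iT jT).
have [[aj ij] ia] : ((a != j) * (i != j)) * (i != a) by do !split; rewrite eq_sym.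
have [jN aN] : j \notin T :\ i :\ a /\ a \notin T :\ i :\ a by rewrite setD11 !notinD1.
have iN : i \notin T :\ i :\ a by rewrite notinD1 ?setD11.
by rewrite -mulrA brP // tpermR tpermD // PC !mulrA word_P // setD11C.
Qed.

(* The sum of [a_1 b_1]...[a_m b_m] over all orderings a_1,...,a_m of T and all
   sequences b_1,...,b_m of elements of bs that are nondecreasing for the order
   of the list bs. *)
Fixpoint words (bs : seq I) T : A :=
  if bs is b :: bs' then \sum_(U : {set I} | U \subset T) word b U * words bs' (T :\: U)
  else (T == set0)%:R.

Lemma words_comm x bs T : (forall b i, b \in bs -> i \in T -> x * br i b = br i b * x) ->
  x * words bs T = words bs T * x.
Proof.
elim: bs T => [|b bs IH] T H /=; first by rewrite delta_comm.
rewrite mulr_sumr mulr_suml; apply: eq_bigr => U /subsetP UT.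
rewrite mulrA word_comm => [|i /UT iT]; last by rewrite H // mem_head.
rewrite -!mulrA IH // => d i dbs; rewrite inE => /andP[_ iT].
by rewrite H // inE dbs orbT.
Qed.

Lemma br_words_comm p a bs T : p != a -> p \notin T -> a \notin T ->
  p \notin bs -> a \notin bs -> (forall b, b \in bs -> b \notin T) ->
  br p a * words bs T = words bs T * br p a.
Proof.
move=> pa pT aT pbs abs bsT; apply: words_comm => b i bb iT.
apply: br_comm => //; [|exact: neq_notin iT pT| |exact: neq_notin iT aT|].
- by rewrite eq_sym (neq_notin iT) // bsT.
- by apply: contraNneq pbs => ->.
- by apply: contraNneq abs => ->.
Qed.

Lemma word_words_comm j bs U W : [disjoint U & W] -> j \notin bs ->
    (forall b, b \in j :: bs -> b \notin U :|: W) ->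
  word j U * words bs W = words bs W * word j U.
Proof.
move=> dUW jbs H; apply/esym/word_comm => i iU; apply/esym/br_words_comm.
- rewrite eq_sym; apply: (neq_notin iU).
  by have := H j (mem_head _ _); rewrite inE => /norP[].
- by rewrite (disjointFr dUW).
- by have := H j (mem_head _ _); rewrite inE => /norP[].
- by apply/negP => ibs; have := H i; rewrite !inE ibs orbT iU => /(_ isT).
- by [].
- by move=> b bbs; have := H b; rewrite !inE bbs orbT => /(_ isT) /norP[].
Qed.

Lemma setU_setD U T : U \subset T -> U :|: T :\: U = T.
Proof. by move=> UT; rewrite -{1}(setIidPr UT) setID. Qed.

Lemma disjointD U T : [disjoint U & T :\: U].
Proof. by rewrite -setI_eq0 setIDA setIC -setIDA setDv setI0. Qed.

Lemma words_rcons_letter j bs T : j \notin bs -> (forall b, b \in j :: bs -> b \notin T) ->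
  words (j :: bs) T = \sum_(U : {set I} | U \subset T) words bs U * word j (T :\: U).
Proof.
move=> jbs H /=; rewrite -[RHS](sum_subsetC T (fun U V => words bs V * word j U)).
apply: eq_bigr => U UT; apply: word_words_comm => // [|b bb]; first exact: disjointD.
by rewrite setU_setD // H.
Qed.

Lemma wordsCA b d bs T : b != d -> (forall e, e \in [:: b, d & bs] -> e \notin T) ->
  words [:: b, d & bs] T = words [:: d, b & bs] T.
Proof.
move=> bd H /=.
have E x y : \sum_(U : {set I} | U \subset T) word x U *
    (\sum_(V : {set I} | V \subset T :\: U) word y V * words bs (T :\: U :\: V)) =
  \sum_(U : {set I} | U \subset T)
    (\sum_(V : {set I} | V \subset U) word x V * word y (U :\: V)) * words bs (T :\: U).
  under [RHS]eq_bigr => U _ do rewrite mulr_suml.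
  rewrite (sum_subsetA T (fun U V W => word x U * word y V * words bs W)).
  by apply: eq_bigr => U _; rewrite mulr_sumr; apply: eq_bigr => V _; rewrite mulrA.
rewrite !E; apply: eq_bigr => U UT; congr (_ * _).
rewrite (sum_subsetC U (fun U V => word b U * word d V)); apply: eq_bigr => V VU.
have [bT dT] : b \notin T /\ d \notin T by split; apply: H; rewrite !inE eqxx ?orbT.
have [bU dU] := (notin_sub UT bT, notin_sub UT dT).
have [bV dV] := (notin_sub VU bU, notin_sub VU dU).
apply/esym/word_comm => i; rewrite inE => /andP[iV iU].
have [bi di] := (neq_notin iU bU, neq_notin iU dU).
by apply/esym/br_word_comm; rewrite // eq_sym.
Qed.

Lemma words_rem b bs T : b \in bs -> uniq bs -> (forall e, e \in bs -> e \notin T) ->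
  words bs T = words (b :: rem b bs) T.
Proof.
elim: bs T => // d bs IH T; rewrite inE => /orP[/eqP <- _ _|bbs]; first by rewrite /= eqxx.
move=> /andP[dbs ubs] H; have bd : b != d by apply: contraNneq dbs => <-.
rewrite [rem b _]/= eq_sym (negbTE bd) wordsCA //; last first.
  move=> e; rewrite !inE => /or3P[/eqP->|/eqP->|/mem_rem ebs]; apply: H;
    by rewrite inE ?eqxx ?bbs ?ebs ?orbT.
apply: eq_bigr => U UT; congr (_ * _); apply: (IH (T :\: U)) => // e ebs.
by rewrite notinD // H // inE ebs orbT.
Qed.

Lemma perm_words bs bs' T : perm_eq bs bs' -> uniq bs -> (forall e, e \in bs -> e \notin T) ->
  words bs T = words bs' T.
Proof.
elim: bs bs' T => [|b bs IH] bs' T; first by rewrite perm_sym => /perm_nilP ->.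
move=> pbs ubs H; have bbs' : b \in bs' by rewrite -(perm_mem pbs) mem_head.
rewrite (@words_rem b bs') //; first last.
- by move=> e; rewrite -(perm_mem pbs); apply: H.
- by rewrite -(perm_uniq pbs).
have pr : perm_eq bs (rem b bs').
  by rewrite -(perm_cons b); apply: perm_trans pbs _; rewrite perm_to_rem.
apply: eq_bigr => U UT; congr (_ * _); apply: IH => //; first by case/andP: ubs.
by move=> e ebs; rewrite notinD // H // inE ebs orbT.
Qed.

(** Either the head letter [b] takes [j], which is [word_insert_conv], or the tail does, which is
    the induction hypothesis. The two factors add up because [U] splits into the indices used with
    [b] and those used with the tail. *)
Lemma words_insert j bs T : j \notin T -> j \notin bs -> uniq bs ->
    (forall b, b \in bs -> b \notin T) ->
  words bs (j |: T) = \sum_(U : {set I} | U \subset T)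
    words bs U * word j (T :\: U) * (\sum_(b <- bs) br j b + \sum_(i in U) br j i).
Proof.
elim: bs T => [|b bs IH] T jT jbs ubs H.
  rewrite [LHS]/= (_ : (_ == _) = false); last by apply/set0Pn; exists j; rewrite setU11.
  rewrite big1 // => U _ /=; case: eqP => [->|_]; last by rewrite !mul0r.
  by rewrite big_nil big_set0 addr0 mulr0.
move: jbs ubs; rewrite inE negb_or /= => /andP[jb jbs] /andP[bbs ubs].
have bT : b \notin T by rewrite H ?mem_head.
have HT e : e \in bs -> e \notin T by move=> ebs; rewrite H // inE ebs orbT.
rewrite sum_subsetU1 //.
transitivity (\sum_(U : {set I} | U \subset T) \sum_(V : {set I} | V \subset T :\: U)
    word b U * words bs V * word j (T :\: U :\: V) * (\sum_(b <- bs) br j b + \sum_(i in V) br j i)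
  + \sum_(U : {set I} | U \subset T) \sum_(V : {set I} | V \subset T :\: U)
    word b U * words bs V * word j (T :\: U :\: V) * (br j b + \sum_(i in U) br j i)).
  congr (_ + _).
    apply: eq_bigr => U UT.
    rewrite (_ : (j |: T) :\: U = j |: (T :\: U)); last first.
      by apply/setP => x; rewrite !inE; case: (x =P j) => // ->; rewrite (notin_sub UT jT).
    rewrite IH ?notinD // => [|e ebs]; last by rewrite notinD ?HT.
    by rewrite mulr_sumr; apply: eq_bigr => V VT; rewrite !mulrA.
  transitivity (\sum_(U : {set I} | U \subset T) \sum_(V : {set I} | V \subset U)
    word b V * word j (U :\: V) * (br j b + \sum_(i in V) br j i) * words bs (T :\: U)).
    apply: eq_bigr => U UT; rewrite word_insert_conv ?(notin_sub UT) 1?eq_sym // mulr_suml.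
    rewrite (_ : (j |: T) :\: (j |: U) = T :\: U) //.
    by apply/setP => x; rewrite !inE; case: (x =P j) => // ->; rewrite (negbTE jT) andbF.
  rewrite (sum_subsetA T (fun V W Z => word b V * word j W * (br j b + \sum_(i in V) br j i) * words bs Z)).
  apply: eq_bigr => U UT.
  rewrite (sum_subsetC (T :\: U) (fun V W => word b U * word j V * (br j b + \sum_(i in U) br j i) * words bs W)).
  apply: eq_bigr => V VTU; rewrite -!mulrA; congr (_ * _); rewrite mulrA.
  have VT : V \subset T by apply: subset_trans VTU (subsetDl _ _).
  rewrite -mulrA (_ : _ * words bs V = words bs V * (br j b + \sum_(i in U) br j i)).
    rewrite !mulrA word_words_comm //.
      by rewrite disjoint_sym disjointD.
    move=> e ebs; rewrite setUC setU_setD //.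
    by move: ebs; rewrite inE => /orP[/eqP ->|ebs]; rewrite notinD // HT.
  rewrite mulrDr mulrDl mulr_suml mulr_sumr; congr (_ + _).
    by apply: br_words_comm; rewrite ?(notin_sub VT) // => e ebs; rewrite (notin_sub VT) ?HT.
  apply: eq_bigr => i iU; have iT : i \in T by apply: (subsetP UT).
  apply: br_words_comm; rewrite ?(notin_sub VT jT) ?(neq_notin iT) //.
  - by apply/negP => iV; have := subsetP VTU _ iV; rewrite inE iU.
  - by apply/negP => /HT; rewrite iT.
  - by move=> e ebs; rewrite (notin_sub VT) ?HT.
under [RHS]eq_bigr => U _.
  rewrite 2!mulr_suml big_cons; over.
transitivity (\sum_(U : {set I} | U \subset T) \sum_(V : {set I} | V \subset U)
   word b V * words bs (U :\: V) * word j (T :\: U) *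
     ((\sum_(b <- bs) br j b + \sum_(i in U :\: V) br j i) + (br j b + \sum_(i in V) br j i))); last first.
  apply: eq_bigr => U _; apply: eq_bigr => V VU; congr (_ * _).
  by rewrite [\sum_(i in U) _](big_setID V) /= (setIidPr VU) addrACA; congr (_ + _); rewrite addrC.
rewrite (sum_subsetA T (fun V W Z => word b V * words bs W * word j Z *
   (\sum_(b <- bs) br j b + \sum_(i in W) br j i + (br j b + \sum_(i in V) br j i)))).
rewrite -big_split /=; apply: eq_bigr => U _; rewrite -big_split /=; apply: eq_bigr => V _.
by rewrite -mulrDr.
Qed.

Arguments words : simpl never.

(** * The two identities for K_B(S) *)

Section Pieri.
Variable f : {set I} -> A.
Hypothesis f_rec : forall j S, j \notin S -> f (j |: S) = \sum_(i in S) P i j * f (S :\ i).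
Hypothesis f_P : forall i j S, i != j -> P i j * f S = f S * P i j.

(* K_B(S), where B is listed by bs and f stands for phi. *)
Definition pieri bs S : A := \sum_(U : {set I} | U \subset S) f U * words bs (S :\: U).

Lemma pieri_rcons_letter j bs S : j \notin bs -> (forall b, b \in j :: bs -> b \notin S) ->
  pieri (j :: bs) S = \sum_(U : {set I} | U \subset S) pieri bs U * word j (S :\: U).
Proof.
move=> jbs H; rewrite /pieri; under [RHS]eq_bigr => U _ do rewrite mulr_suml.
rewrite (sum_subsetA S (fun V W Z => f V * words bs W * word j Z)).
apply: eq_bigr => U US; rewrite words_rcons_letter // => [|b bb]; last by rewrite notinD ?H.
by rewrite mulr_sumr; apply: eq_bigr => V _; rewrite mulrA.
Qed.

Lemma perm_pieri bs bs' S : perm_eq bs bs' -> uniq bs -> (forall e, e \in bs -> e \notin S) ->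
  pieri bs S = pieri bs' S.
Proof.
move=> pbs ubs H; apply: eq_bigr => U US; congr (_ * _); apply: perm_words => // e ebs.
by rewrite notinD ?H.
Qed.

Lemma pieri_step j bs S : j \notin bs -> (forall b, b \in j :: bs -> b \notin S) ->
  pieri (j :: bs) S = pieri bs S + \sum_(i in S) pieri (j :: bs) (S :\ i) * br i j.
Proof.
move=> jbs H; rewrite pieri_rcons_letter //.
under eq_bigr => U _ do rewrite wordEr mulrDr delta_comm mulr_sumr.
rewrite big_split /= sum_subset_setD0; congr (_ + _).
rewrite sum_subset_notin; apply: eq_bigr => i iS.
rewrite pieri_rcons_letter // => [|b bb]; last by rewrite notinD1 ?H.
by rewrite mulr_suml; apply: eq_bigr => U _; rewrite mulrA setD1D.
Qed.

Lemma pieri_P bs i j S : i != j -> i \notin S -> j \notin S -> i \notin bs -> j \notin bs ->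
  (forall b, b \in bs -> b \notin S) ->
  P i j * pieri bs S = pieri bs S * P i j.
Proof.
move=> ij iS jS ibs jbs H; rewrite mulr_sumr mulr_suml; apply: eq_bigr => U US.
rewrite mulrA f_P // -!mulrA; congr (_ * _); apply: words_comm => b k bbs kS.
have kS' : k \in S by move: kS; rewrite inE => /andP[].
have kb : k != b by rewrite eq_sym (neq_notin kS') ?H.
have [ik jk] := (neq_notin kS' iS, neq_notin kS' jS).
have [bi bj] : b != i /\ b != j by split; [apply: contraNneq ibs => <-|apply: contraNneq jbs => <-].
by rewrite brP // !tpermD // eq_sym.
Qed.

Lemma pieri_c bs i j S : (forall b, b \in bs -> b \notin S) ->
  (forall U, c i j * f U = f U * c i j) ->
  c i j * pieri bs S = pieri bs S * c i j.
Proof.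
move=> H fc; rewrite mulr_sumr mulr_suml; apply: eq_bigr => U US.
rewrite mulrA fc -!mulrA; congr (_ * _); apply: words_comm => b k bbs kS.
rewrite brc //; have kS' : k \in S by move: kS; rewrite inE => /andP[].
by rewrite eq_sym (neq_notin kS') ?H.
Qed.

(** [j] is used either in a word, giving [words_insert], or by [f], giving [f_rec] and the last
    sum. *)
Lemma pieri_insert j bs S : j \notin S -> j \notin bs -> uniq bs ->
    (forall b, b \in bs -> b \notin S) ->
  pieri bs (j |: S) =
    \sum_(U : {set I} | U \subset S) \sum_(V : {set I} | V \subset S :\: U)
       f U * words bs V * word j (S :\: U :\: V) * (\sum_(b <- bs) br j b + \sum_(i in V) br j i)
    + \sum_(i in S) P i j * pieri bs (S :\ i).
Proof.
move=> jS jbs ubs H; rewrite /pieri sum_subsetU1 //; congr (_ + _).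
  apply: eq_bigr => U US.
  rewrite (_ : (j |: S) :\: U = j |: (S :\: U)); last first.
    by apply/setP => x; rewrite !inE; case: (x =P j) => // ->; rewrite (notin_sub US jS).
  rewrite words_insert ?notinD // => [|b bb]; last by rewrite notinD ?H.
  by rewrite mulr_sumr; apply: eq_bigr => V VS; rewrite !mulrA.
under eq_bigr => U US.
  rewrite f_rec ?(notin_sub US) // mulr_suml.
  rewrite (_ : (j |: S) :\: (j |: U) = S :\: U); last first.
    by apply/setP => x; rewrite !inE; case: (x =P j) => // ->; rewrite (negbTE jS) andbF.
  over.
rewrite /= (sum_subset_in S (fun i U => P i j * f (U :\ i) * words bs (S :\: U))).
apply: eq_bigr => i iS; rewrite mulr_sumr; apply: eq_bigr => U; rewrite subsetD1 => /andP[US iU].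
by rewrite setU1K // setDDl mulrA.
Qed.

(** The index [i] of a factor [br j i] is used by [words bs], by [f] or by [word j]. The first case
    reproduces the triple sum of [pieri_insert]. For [f], the expansion along [i] gives terms in
    [P a i] with a minus sign. For [word j], [word_top] gives the same terms with a plus sign, the
    sum in [P i j] that [pieri_insert] requires, and minus the sum in [c], which the last summand
    restores. *)
Lemma pieri_dunkl j bs S : j \notin S -> j \notin bs -> uniq bs ->
    (forall b, b \in bs -> b \notin S) ->
  (forall i U, c i j * f U = f U * c i j) ->
  pieri bs (j |: S) = pieri (j :: bs) S * (\sum_(b <- bs) br j b + \sum_(i in S) br j i)
    + \sum_(i in S) c i j * pieri [:: i, j & bs] (S :\ i).
Proof.
move=> jS jbs ubs H fc; rewrite pieri_insert //.
have Hj b : b \in j :: bs -> b \notin S by rewrite inE => /orP[/eqP ->|/H].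
have toJ U i : i \in S -> U \subset S :\ i ->
    forall b, b \in j :: bs -> b \notin U.
  by move=> iS US b /Hj bS; rewrite (notin_sub US) // notinD1.
(* the letters of S split into those used by f, by words bs and by word j *)
have splitS : pieri (j :: bs) S * (\sum_(b <- bs) br j b + \sum_(i in S) br j i) =
    \sum_(U : {set I} | U \subset S) \sum_(V : {set I} | V \subset S :\: U)
       f U * words bs V * word j (S :\: U :\: V) * (\sum_(b <- bs) br j b + \sum_(i in V) br j i)
    + (\sum_(U : {set I} | U \subset S) \sum_(i in U) f U * words (j :: bs) (S :\: U) * br j i
    + \sum_(U : {set I} | U \subset S) pieri bs U * (\sum_(i in S :\: U) word j (S :\: U) * br j i)).
  have E : \sum_(U : {set I} | U \subset S) pieri bs U * (\sum_(i in S :\: U) word j (S :\: U) * br j i)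
    = \sum_(U : {set I} | U \subset S) \sum_(V : {set I} | V \subset S :\: U)
       f U * words bs V * word j (S :\: U :\: V) * (\sum_(i in S :\: U :\: V) br j i).
    rewrite -(sum_subsetA S (fun U V W => f U * words bs V * word j W * (\sum_(i in W) br j i))).
    apply: eq_bigr => U US; rewrite mulr_suml; apply: eq_bigr => V VU.
    by rewrite -mulr_sumr mulrA.
  rewrite E -!big_split /= {1}/pieri mulr_suml; apply: eq_bigr => U US.
  rewrite addrCA -big_split /= words_rcons_letter ?notinD // => [|b bb]; last by rewrite notinD ?Hj.
  rewrite mulr_sumr mulr_suml.
  rewrite -[X in _ = X + _]mulr_sumr mulr_suml -big_split /=.
  apply: eq_bigr => V VSU; rewrite -mulrDr !mulrA -mulrDr; congr (_ * _).
  rewrite (big_setID U) /= (setIidPr US) (big_setID V (A := S :\: U)) /= (setIidPr VSU).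
  by rewrite !addrA; congr (_ + _ + _); rewrite addrC.
rewrite splitS -!addrA; congr (_ + _).
have neqj i : i \in S -> i != j by move=> iS; rewrite eq_sym (neq_notin iS).
have -> : \sum_(U : {set I} | U \subset S) \sum_(i in U) f U * words (j :: bs) (S :\: U) * br j i =
    - \sum_(i in S) \sum_(a in S :\ i) P a i * (pieri (j :: bs) (S :\ i :\ a) * br i j).
  rewrite (sum_subset_in S (fun i U => f U * words (j :: bs) (S :\: U) * br j i)) -sumrN.
  apply: eq_bigr => i iS.
  under eq_bigr => U.
    rewrite subsetD1 => /andP[US iU].
    rewrite f_rec // (brN (neqj i iS)) mulrN -setDDl -mulrA mulr_suml; over.
  rewrite /= sumrN; congr (- _).
  rewrite (sum_subset_in (S :\ i) (fun a U => P a i * f (U :\ a) * (words (j :: bs) (S :\ i :\: U) * br i j))).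
  apply: eq_bigr => a aSi; rewrite /pieri mulr_suml mulr_sumr; apply: eq_bigr => U.
  by rewrite subsetD1 => /andP[US aU]; rewrite setU1K // !mulrA -setDDl.
have -> : \sum_(U : {set I} | U \subset S) pieri bs U * (\sum_(i in S :\: U) word j (S :\: U) * br j i) =
    \sum_(i in S) \sum_(a in S :\ i) P a i * (pieri (j :: bs) (S :\ i :\ a) * br i j)
    + \sum_(i in S) P i j * pieri bs (S :\ i)
    - \sum_(i in S) c i j * pieri [:: i, j & bs] (S :\ i).
  under eq_bigr => U US.
    rewrite (_ : \sum_(i in S :\: U) word j (S :\: U) * br j i =
      - \sum_(i in S :\: U) word j (S :\: U) * br i j); last first.
      rewrite -sumrN; apply: eq_bigr => i; rewrite inE => /andP[_ iS].
      by rewrite (brN (neqj i iS)) mulrN.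
    rewrite word_top ?notinD // !opprB addrA mulrBr mulrDr 3!mulr_sumr; over.
  rewrite /= sumrB big_split /= !sum_subset_notin.
  congr (_ + _ - _).
  - apply: eq_bigr => i iS.
    under [LHS]eq_bigr => U _ do rewrite mulr_sumr setD1D'.
    rewrite (sum_subset_notin (S :\ i) (fun a U =>
      pieri bs U * (P a i * (word j (S :\ i :\: U :\ a) * br i j)))).
    apply: eq_bigr => a aSi; rewrite pieri_rcons_letter //; last first.
      by move=> b /Hj bS; rewrite !notinD1.
    rewrite mulr_suml mulr_sumr; apply: eq_bigr => U; rewrite subsetD1 => /andP[US aU].
    move: US aSi; rewrite subsetD1 in_setD1 => /andP[US iU] /andP[ai aS].
    rewrite !mulrA pieri_P ?setD11 ?(setD1D a (S :\ i) U) //.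
    + by apply/negP => /H; rewrite aS.
    + by apply/negP => /H; rewrite iS.
    + by move=> b /H bS; rewrite (notin_sub US).
  - apply: eq_bigr => i iS; under [LHS]eq_bigr => U _ do rewrite setD1D' mulrA delta_comm -mulrA.
    rewrite sum_subset_setD0 pieri_P ?neqj ?setD11 ?notinD1 //.
    + by apply/negP => /H; rewrite iS.
    + by move=> b /H bS; rewrite notinD1.
  - apply: eq_bigr => i iS.
    have iN : i \notin j :: bs by apply/negP => /Hj; rewrite iS.
    rewrite pieri_rcons_letter //; last first.
      by move=> b; rewrite inE => /orP[/eqP ->|/Hj bS]; rewrite ?setD11 ?notinD1.
    transitivity (c i j * \sum_(U : {set I} | U \subset S :\ i) \sum_(V : {set I} | V \subset U)
        pieri bs V * word j (U :\: V) * word i (S :\ i :\: U)); last first.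
      congr (_ * _); apply: eq_bigr => U US; rewrite pieri_rcons_letter ?mulr_suml //.
      exact: toJ US.
    rewrite (sum_subsetA (S :\ i) (fun V W Z => pieri bs V * word j W * word i Z)) mulr_sumr.
    apply: eq_bigr => U US; rewrite mulrA -pieri_c //; last first.
      by move=> b bb; rewrite (toJ U i) // inE bb orbT.
    rewrite -mulrA; congr (_ * _); rewrite setD1D' mulr_sumr; apply: eq_bigr => V _.
    by rewrite mulrA.
by rewrite subrK addKr.
Qed.
End Pieri.
End Brackets.

(** * Sums over sequences and matchings *)

Section FfunCons.
Variables (X : finType) (m : nat).

Definition fcons (x : X) (g : {ffun 'I_m -> X}) : {ffun 'I_m.+1 -> X} :=
  [ffun t => if unlift ord0 t is Some u then g u else x].

Lemma fcons0 x g : fcons x g ord0 = x.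
Proof. by rewrite ffunE unlift_none. Qed.

Lemma fconsS x g t : fcons x g (lift ord0 t) = g t.
Proof. by rewrite ffunE liftK. Qed.

Lemma forall_fcons (Q : 'I_m.+1 -> bool) :
  [forall t, Q t] = Q ord0 && [forall t, Q (lift ord0 t)].
Proof.
apply/forallP/andP => [H|[H0 /forallP H] t]; first by split; last apply/forallP.
by case: (unliftP ord0 t) => [u ->|->].
Qed.

Lemma big_fcons (A : nmodType) (Q : pred {ffun 'I_m.+1 -> X}) (F : {ffun 'I_m.+1 -> X} -> A) :
  \sum_(g | Q g) F g = \sum_(x : X) \sum_(g | Q (fcons x g)) F (fcons x g).
Proof.
rewrite pair_big_dep /= (reindex (fun p : X * {ffun 'I_m -> X} => fcons p.1 p.2)) //=.
exists (fun g : {ffun 'I_m.+1 -> X} => (g ord0, [ffun t => g (lift ord0 t)])).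
  move=> [x g] _; rewrite fcons0; congr pair.
  by apply/ffunP => t; rewrite ffunE fconsS.
move=> g _; apply/ffunP => t; case: (unliftP ord0 t) => [u ->|->].
  by rewrite fconsS ffunE.
by rewrite fcons0.
Qed.
End FfunCons.

Lemma big_ffun0 (X : finType) (A : nmodType) (Q : pred {ffun 'I_0 -> X}) (F : {ffun 'I_0 -> X} -> A)
    (g0 : {ffun 'I_0 -> X}) : Q g0 -> \sum_(g | Q g) F g = F g0.
Proof.
move=> Qg; rewrite (bigD1 g0) //= big1 ?addr0 // => g /andP[_ /eqP[]].
by apply/ffunP => -[].
Qed.

Arguments words : simpl never.

(** * Sums over the sequences of the theorem *)

Section Star.
Variables (n : nat) (A : pzRingType) (br : 'I_n -> 'I_n -> A).

(** [star_seq] with the admissible first and second indices as parameters, since the induction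
    shrinks both. *)
Definition starP (D : {set 'I_n}) (bs : seq 'I_n) (m : nat) (ab : {ffun 'I_m -> 'I_n * 'I_n}) :=
  [&& [forall t, (ab t).1 \in D],
      [forall t, (ab t).2 \in bs],
      [forall t1 : 'I_m, forall t2 : 'I_m, ((ab t1).1 == (ab t2).1) ==> (t1 == t2)] &
      [forall t1 : 'I_m, forall t2 : 'I_m, ((t1 <= t2)%N ==> ((ab t1).2 <= (ab t2).2)%N)]].

Lemma starP_fcons D bs m x (g : {ffun 'I_m -> 'I_n * 'I_n}) :
  starP D bs (fcons x g) =
  [&& x.1 \in D, x.2 \in bs, starP (D :\ x.1) bs g & [forall t, (x.2 <= (g t).2)%N]].
Proof.
rewrite /starP (forall_fcons (fun t => (fcons x g t).1 \in D)) (forall_fcons (fun t => (fcons x g t).2 \in bs))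
  (forall_fcons (fun t1 => [forall t2 : 'I_m.+1, ((fcons x g t1).1 == (fcons x g t2).1) ==> (t1 == t2)]))
  (forall_fcons (fun t1 => [forall t2 : 'I_m.+1, (t1 <= t2)%N ==> ((fcons x g t1).2 <= (fcons x g t2).2)%N])) !fcons0.
have lift0 (t : 'I_m) : (lift ord0 t == ord0) = false by apply/eqP => /(congr1 val).
have E1 : [forall t, (fcons x g (lift ord0 t)).1 \in D] = [forall t, (g t).1 \in D].
  by apply: eq_forallb => t; rewrite fconsS.
have E2 : [forall t, (fcons x g (lift ord0 t)).2 \in bs] = [forall t, (g t).2 \in bs].
  by apply: eq_forallb => t; rewrite fconsS.
have E3 : [forall t1 : 'I_m.+1, (x.1 == (fcons x g t1).1) ==> (ord0 == t1)] =
    [forall t, x.1 != (g t).1].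
  rewrite forall_fcons eqxx implybT; apply: eq_forallb => t.
  by rewrite fconsS [ord0 == _]eq_sym lift0 implybF.
have E4 : [forall t1 : 'I_m, forall t2 : 'I_m.+1,
     ((fcons x g (lift ord0 t1)).1 == (fcons x g t2).1) ==> (lift ord0 t1 == t2)] =
   [forall t, x.1 != (g t).1] &&
   [forall t1 : 'I_m, forall t2 : 'I_m, ((g t1).1 == (g t2).1) ==> (t1 == t2)].
  apply/forallP/andP => [H|[/forallP H1 /forallP H2] t].
    split; apply/forallP => t; have := H t; rewrite forall_fcons fcons0 !fconsS lift0 implybF => /andP[].
      by rewrite eq_sym.
    move=> _ /forallP Ht; apply/forallP => u; have := Ht u; rewrite fconsS.
    by rewrite (inj_eq lift_inj).
  rewrite forall_fcons fcons0 fconsS lift0 implybF eq_sym H1 /=.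
  by apply/forallP => u; rewrite fconsS (inj_eq lift_inj); apply: (forallP (H2 t)).
have E5 : [forall t : 'I_m.+1, (0 <= t)%N ==> (x.2 <= (fcons x g t).2)%N] =
    [forall t, (x.2 <= (g t).2)%N].
  by rewrite forall_fcons fcons0 leqnn /=; apply: eq_forallb => t; rewrite fconsS.
have E6 : [forall t1 : 'I_m, forall t2 : 'I_m.+1,
     (lift ord0 t1 <= t2)%N ==> ((fcons x g (lift ord0 t1)).2 <= (fcons x g t2).2)%N] =
   [forall t1 : 'I_m, forall t2 : 'I_m, ((t1 <= t2)%N ==> ((g t1).2 <= (g t2).2)%N)].
  apply: eq_forallb => t; rewrite forall_fcons /=; apply: eq_forallb => u.
  by rewrite !fconsS /bump /= !add1n ltnS.
rewrite E1 E2 E3 E4 E5 E6.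
have -> : [forall t, (g t).1 \in D :\ x.1] = [forall t, x.1 != (g t).1] && [forall t, (g t).1 \in D].
  apply/forallP/andP => [H|[/forallP H1 /forallP H2] t].
    by split; apply/forallP => t; have := H t; rewrite in_setD1 eq_sym => /andP[].
  by rewrite in_setD1 eq_sym H1 H2.
do ![case: (_ \in _) => //=]; do ![case: [forall _, _] => //=].
Qed.

(** The alternative is whether the block of the head letter [b] is empty. *)
Lemma words_consE b bs T : words br (b :: bs) T =
  words br bs T + \sum_(a in T) br a b * words br (b :: bs) (T :\ a).
Proof.
rewrite {1}/words -/(words br); under eq_bigr => U _ do rewrite wordE mulrDl mulr_suml.
rewrite big_split /=; congr (_ + _).
  rewrite (bigD1 set0) ?sub0set //= eqxx mul1r setD0 big1 ?addr0 // => U /andP[_ /negbTE ->].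
  by rewrite mul0r.
rewrite (sum_subset_in T (fun a U => br a b * word br b (U :\ a) * words br bs (T :\: U))).
apply: eq_bigr => a aT; rewrite {2}/words -/(words br) mulr_sumr; apply: eq_bigr => U.
by rewrite subsetD1 => /andP[UT aU]; rewrite setU1K // setDDl mulrA.
Qed.

Lemma words0 bs : words br bs set0 = 1.
Proof. by elim: bs => [|b bs IH]; rewrite ?words_consE ?big_set0 ?addr0 // /words eqxx. Qed.

(** A nondecreasing sequence has the least letter [b] at its first place or nowhere, which is the
    alternative of [words_consE]. *)
Lemma sum_starP (D : {set 'I_n}) bs m : pairwise (fun i j : 'I_n => (i < j)%N) bs ->
  \sum_(ab : {ffun 'I_m -> 'I_n * 'I_n} | starP D bs ab) \prod_(t < m) br (ab t).1 (ab t).2 =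
  \sum_(T : {set 'I_n} | T \subset D) (#|T| == m)%:R * words br bs T.
Proof.
elim: m D bs => [|m IHm] D bs pbs.
  rewrite (@big_ffun0 _ _ _ _ (ffun0 (card_ord 0))); last first.
    by apply/and4P; split; apply/forallP => -[].
  rewrite big_ord0 (bigD1 set0) ?sub0set //= cards0 eqxx words0 mul1r big1 ?addr0 // => T /andP[_ T0].
  by rewrite cards_eq0 (negbTE T0) mul0r.
elim: bs pbs => [|b bs IHbs] /=.
  rewrite big_pred0; last first.
    move=> ab; apply/negP => /and4P[_ /forallP /(_ ord0)]; by rewrite in_nil.
  rewrite big1 // => T _; rewrite /words; case: (T =P set0) => [->|_]; last by rewrite mulr0.
  by rewrite cards0 mul0r.
move=> /andP[/allP bmin pbs]; have {}IHbs := IHbs pbs.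
rewrite (bigID (fun ab : {ffun 'I_m.+1 -> 'I_n * 'I_n} => (ab ord0).2 == b)) /=.
under [RHS]eq_bigr => T _ do rewrite words_consE mulrDr mulr_sumr.
rewrite big_split /= addrC; congr (_ + _).
  rewrite -IHbs; apply: eq_bigl => ab; apply/andP/idP.
    move=> [/and4P[H1 /forallP H2 H3 H4] n0]; apply/and4P; split=> //; apply/forallP => t.
    have := H2 t; rewrite inE => /orP[/eqP E|//].
    have := H2 ord0; rewrite inE (negbTE n0) /= => /bmin; rewrite ltnNge -E.
    by have /forallP /(_ t) := forallP H4 ord0; rewrite leq0n /= => ->.
  move=> /and4P[H1 /forallP H2 H3 H4]; split.
    by apply/and4P; split=> //; apply/forallP => t; rewrite inE H2 orbT.
  by apply/eqP => E; have := bmin _ (H2 ord0); rewrite E ltnn.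
rewrite big_mkcondr big_fcons /=.
transitivity (\sum_(a in D) br a b * \sum_(g : {ffun 'I_m -> 'I_n * 'I_n} | starP (D :\ a) (b :: bs) g)
    \prod_(t < m) br (g t).1 (g t).2).
  transitivity (\sum_a \sum_d \sum_(g : {ffun 'I_m -> 'I_n * 'I_n} | starP D (b :: bs) (fcons (a, d) g))
     if (fcons (a, d) g ord0).2 == b then \prod_(t < m.+1) br (fcons (a, d) g t).1 (fcons (a, d) g t).2 else 0).
    by rewrite pair_bigA /=; apply: eq_bigr => -[a d] _.
  rewrite [RHS]big_mkcond /=; apply: eq_bigr => a _.
  rewrite (bigD1 b) //= [X in _ + X]big1 ?addr0; last first.
    by move=> d /negbTE db; rewrite big1 // => g _; rewrite fcons0 /= db.
  case: ifP => aD; last by rewrite big_pred0 // => g; rewrite starP_fcons /= aD.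
  rewrite mulr_sumr; apply: eq_big => [g|g _].
    rewrite starP_fcons /= aD mem_head /= andbC.
    case: (boolP (starP _ _ g)) => [/and4P[_ /forallP H _ _]|]; rewrite ?andbF //= andbT.
    apply/forallP => t; have := H t; rewrite inE => /orP[/eqP ->//|/bmin]; exact: ltnW.
  rewrite fcons0 eqxx big_ord_recl fcons0 /=; congr (_ * _).
  by apply: eq_bigr => t _; rewrite fconsS.
rewrite (sum_subset_in D (fun a T => (#|T| == m.+1)%:R * (br a b * words br (b :: bs) (T :\ a)))).
apply: eq_bigr => a aD; rewrite IHm /= ?pbs ?andbT; last by apply/allP.
rewrite mulr_sumr; apply: eq_bigr => T; rewrite subsetD1 => /andP[TD aT].
by rewrite setU1K // cardsU1 aT add1n eqSS !mulrA delta_comm.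
Qed.

Lemma sum_star_seq (I I0 : {set 'I_n}) m :
  \sum_(ab : {ffun 'I_m -> 'I_n * 'I_n} | star_seq I I0 ab) \prod_(t < m) br (ab t).1 (ab t).2 =
  \sum_(T : {set 'I_n} | T \subset I :\: I0) (#|T| == m)%:R * words br (enum (~: I)) T.
Proof.
rewrite -sum_starP.
  apply: eq_bigl => ab; congr [&& _, _, _ & _]; apply: eq_forallb => t.
  by rewrite mem_enum inE.
have tr : transitive (fun i j : 'I_n => (i < j)%N) by move=> y x z; apply: ltn_trans.
rewrite -(sorted_pairwise tr) /enum_mem sorted_filter // -enumT.
by have := iota_ltn_sorted 0 n; rewrite -val_enum_ord sorted_map.
Qed.
End Star.

(** * Expansion of a hafnian along a pivot *)

Section Matchings.
Variables (n : nat) (K : comPzRingType) (W : 'I_n -> 'I_n -> K).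
Hypothesis WC : forall i j, W i j = W j i.
Implicit Types (S T : {set 'I_n}).

Definition matching_sum m S : K :=
  \sum_(ab : {ffun 'I_m -> 'I_n * 'I_n} | is_matching S ab) \prod_(t < m) W (ab t).1 (ab t).2.

(** [phi] is the hafnian of the matrix wp(x_i - x_j) at each point x, so the expansion is done with
    commuting scalars and only afterwards carried over by [iota]. *)
Definition hafnian S : K := matching_sum (#|S| %/ 2) S.

Lemma cardsD2 S a b : a \in S -> b \in S :\ a -> #|S| = (#|S :\ a :\ b|).+2.
Proof. by move=> aS bS; rewrite (cardsD1 a S) aS (cardsD1 b (S :\ a)) bS !add1n. Qed.

(** The conditions a_1 < a_2 < ... and a_t < b_t force the least element of [S] to be a_1. *)
Lemma is_matching_fcons m S (a : 'I_n) x (g : {ffun 'I_m -> 'I_n * 'I_n}) :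
    a \in S -> (forall s, s \in S -> (a <= s)%N) ->
  is_matching S (fcons x g) = [&& x.1 == a, x.2 \in S :\ a & is_matching (S :\ a :\ x.2) g].
Proof.
move=> aS amin; set T := [set (g t).1 | t in 'I_m] :|: [set (g t).2 | t in 'I_m].
have TE : [set (fcons x g t).1 | t in 'I_m.+1] :|: [set (fcons x g t).2 | t in 'I_m.+1]
    = [set x.1; x.2] :|: T.
  apply/setP => y; rewrite !inE; apply/orP/idP.
    case=> /imsetP[t _ ->]; case: (unliftP ord0 t) => [u ->|->]; rewrite ?fcons0 ?eqxx ?orbT //.
      by rewrite fconsS (imset_f (fun t => (g t).1)) ?orbT.
    by rewrite fconsS (imset_f (fun t => (g t).2)) ?orbT.
  case/orP => [/orP[/eqP->|/eqP->]|/orP[/imsetP[t _ ->]|/imsetP[t _ ->]]].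
  - by left; apply/imsetP; exists ord0 => //; rewrite fcons0.
  - by right; apply/imsetP; exists ord0 => //; rewrite fcons0.
  - by left; apply/imsetP; exists (lift ord0 t) => //; rewrite fconsS.
  - by right; apply/imsetP; exists (lift ord0 t) => //; rewrite fconsS.
have cT : (#|T| <= 2 * m)%N.
  rewrite cardsU mul2n -addnn; apply: leq_trans (leq_subr _ _) _.
  by apply: leq_add; rewrite -[leqRHS](card_ord m); apply: leq_imset_card.
have inT t : ((g t).1 \in T) * ((g t).2 \in T).
  by rewrite !inE (imset_f (fun t => (g t).1)) ?(imset_f (fun t => (g t).2)) ?orbT.
rewrite /is_matching TE; apply/and4P/and3P.
  move=> [/forallP H1 /forallP H2 /eqP H3 /eqP H4].
  have x12 : (x.1 < x.2)%N by have := H1 ord0; rewrite fcons0.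
  have gt t : ((g t).1 < (g t).2)%N by have := H1 (lift ord0 t); rewrite fconsS.
  have xg t : (x.1 < (g t).1)%N.
    by have /forallP /(_ (lift ord0 t)) := H2 ord0; rewrite fcons0 fconsS.
  have xT y : y \in T -> (x.1 < y)%N.
    by rewrite inE => /orP[/imsetP[t _ ->]|/imsetP[t _ ->]]; rewrite ?xg ?(ltn_trans (xg t)).
  have x1S : x.1 \in S by rewrite H4 !inE eqxx.
  have ax : x.1 = a.
    apply/val_inj/eqP; rewrite eqn_leq amin // andbT leqNgt; apply/negP => ax.
    move: aS; rewrite H4 !inE => /orP[/orP[/eqP E|/eqP E]|].
    - by rewrite E ltnn in ax.
    - by rewrite E ltnNge ltnW in ax.
    - by rewrite -in_setU => /xT; rewrite ltnNge ltnW.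
  have x1T : x.1 \notin T by apply/negP => /xT; rewrite ltnn.
  have x2T : x.2 \notin T.
    (* Disjointness of the pairs is encoded by cardinality: if [x.2] were in [T], then [S] would
       have at most 2m+1 elements instead of 2m+2. *)
    apply/negP => x2T; have : (#|S| <= (2 * m).+1)%N.
      rewrite H4 -setUA [_ :|: T](setUidPr _) ?sub1set // cardsU1 x1T add1n ltnS //.
    by rewrite -H3 mulnS ltnn.
  have x21 : x.2 != x.1 by apply/eqP => E; rewrite E ltnn in x12.
  have ST : S :\ a :\ x.2 = T.
    apply/setP => y; rewrite -ax H4 !in_setD1 in_setU in_set2.
    case: (y =P x.2) => [->|_] /=; first by rewrite (negbTE x2T).
    by case: (y =P x.1) => [->|_] /=; rewrite ?(negbTE x1T).
  split; first by rewrite ax.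
    by rewrite in_setD1 -ax x21 H4 !inE eqxx orbT.
  apply/and4P; split; last by rewrite ST.
  - by apply/forallP => t; have := H1 (lift ord0 t); rewrite fconsS.
  - apply/forallP => t; apply/forallP => u; have /forallP /(_ (lift ord0 u)) := H2 (lift ord0 t).
    by rewrite !fconsS /= /bump /= !add1n ltnS.
  - move: H3; rewrite (@cardsD2 _ _ x.2 aS) ?mulnS ?add2n => [[->] //|].
    by rewrite in_setD1 -ax x21 H4 !inE eqxx orbT.
move=> [/eqP xa x2 /and4P[/forallP H1 /forallP H2 /eqP H3 /eqP H4]].
have TS t : (g t).1 \in S :\ a by have [+ _] := inT t; rewrite /T -H4 in_setD1 => /andP[].
have lta y : y \in S :\ a -> (a < y)%N.
  by rewrite in_setD1 ltn_neqAle => /andP[ya /amin ->]; rewrite andbT eq_sym.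
split.
- rewrite forall_fcons fcons0 xa lta //=; apply/forallP => t; rewrite fconsS; exact: H1.
- apply/forallP => t; apply/forallP => u.
  case: (unliftP ord0 t) => [t' ->|->]; case: (unliftP ord0 u) => [u' ->|->]; rewrite ?fcons0 ?fconsS //.
    by have /forallP /(_ u') := H2 t'; rewrite /= /bump /= !add1n ltnS.
  by rewrite xa lta ?TS ?implybT.
- by rewrite (cardsD2 aS x2) -H3 mulnS.
- apply/eqP; rewrite /T -H4 xa -setUA setD1K // setD1K //.
Qed.

Lemma hafnian0 : hafnian set0 = 1.
Proof.
rewrite /hafnian cards0 div0n /matching_sum (@big_ffun0 _ _ _ _ (ffun0 (card_ord 0))) ?big_ord0 //.
apply/and4P; split; try by apply/forallP => -[].
  by rewrite cards0.
by apply/eqP/esym; rewrite -[RHS]setU0; congr (_ :|: _); apply/setP => x; rewrite inE; apply/imsetP => -[[]].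
Qed.

Lemma hafnian_odd S : odd #|S| -> hafnian S = 0.
Proof.
move=> oS; rewrite /hafnian /matching_sum big_pred0 // => ab; apply/negP => /and4P[_ _ /eqP E _].
by rewrite -E mul2n odd_double in oS.
Qed.

Lemma hafnian_min S a : a \in S -> (forall s, s \in S -> (a <= s)%N) ->
  hafnian S = \sum_(b in S :\ a) W a b * hafnian (S :\ a :\ b).
Proof.
move=> aS amin; have [S0|[b0 b0S]] := set_0Vmem (S :\ a).
  by rewrite S0 big_set0 hafnian_odd // (cardsD1 a) aS S0 cards0.
have cS b : b \in S :\ a -> (#|S| = #|S :\ a :\ b| + 2)%N.
  by move=> bS; rewrite addn2; apply: cardsD2.
rewrite {1}/hafnian (cS b0 b0S) divnDr // divnn /= addn1 /matching_sum big_fcons.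
transitivity (\sum_a' \sum_b \sum_(g : {ffun 'I_(#|S :\ a :\ b0| %/ 2) -> 'I_n * 'I_n} | is_matching S (fcons (a', b) g))
    \prod_t W (fcons (a', b) g t).1 (fcons (a', b) g t).2).
  by rewrite pair_bigA /=; apply: eq_bigr => -[a' b] _.
rewrite (bigD1 a) //= [X in _ + X]big1 ?addr0; last first.
  move=> a' /negbTE aa'; rewrite big1 // => b _; rewrite big_pred0 // => g.
  by rewrite (@is_matching_fcons _ _ a) //= aa'.
rewrite [RHS]big_mkcond /=; apply: eq_bigr => b _; case: ifP => bS; last first.
  by rewrite big_pred0 // => g; rewrite (@is_matching_fcons _ _ a) //= bS andbF.
have -> : #|S :\ a :\ b0| = #|S :\ a :\ b|.
  by apply/eqP; rewrite -(eqn_add2r 2) -!cS.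
rewrite /hafnian mulr_sumr; apply: eq_big => [g|g _].
  by rewrite (@is_matching_fcons _ _ a) //= bS eqxx.
rewrite big_ord_recl fcons0 /=; congr (_ * _).
by apply: eq_bigr => t _; rewrite fconsS.
Qed.

Lemma exists_min S j : j \in S -> exists2 a, a \in S & forall s, s \in S -> (a <= s)%N.
Proof. by move=> jS; case: (arg_minnP (fun i : 'I_n => i : nat) jS) => a aS amin; exists a. Qed.

(** The definition only yields the expansion along the minimum [a]. For another [j], expand along
    [a], then along [j] by induction, and exchange the two sums. *)
Lemma hafnian_pivot S j : j \in S -> hafnian S = \sum_(i in S :\ j) W j i * hafnian (S :\ j :\ i).
Proof.
elim/card_set_ind: S => S IH jS; have [a aS amin] := exists_min jS.
have [<-|aj] := eqVneq a j; first exact: hafnian_min.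
have aSj : a \in S :\ j by rewrite in_setD1 aj.
have jSa : j \in S :\ a by rewrite in_setD1 eq_sym aj.
rewrite (hafnian_min aS amin) (big_setD1 j) //= [RHS](big_setD1 a) //= WC setD11C; congr (_ + _).
transitivity (\sum_(i in S :\ j :\ a) \sum_(k in S :\ j :\ a :\ i) W a i * (W j k * hafnian (S :\ j :\ a :\ i :\ k))).
  apply: eq_bigr => i; rewrite !in_setD1 => /and3P[ia ij iS].
  rewrite IH ?mulr_sumr.
  - by rewrite (_ : S :\ a :\ i :\ j = S :\ j :\ a :\ i) // (setD11C i j) (setD11C a j).
  - by apply: leq_trans (cardsD1_lt _) (ltnW (cardsD1_lt aS)); rewrite in_setD1 ia.
  - by rewrite !in_setD1 eq_sym ij eq_sym aj.
rewrite sum_setD1C; apply: eq_bigr => k; rewrite !in_setD1 => /and3P[ka kj kS].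
rewrite (@hafnian_min _ a).
- rewrite mulr_sumr (setD11C k a); apply: eq_bigr => i _.
  by rewrite mulrCA (setD11C i k).
- by rewrite !in_setD1 eq_sym ka aj.
- by move=> s; rewrite !in_setD1 => /and3P[_ _]; apply: amin.
Qed.

Lemma hafnianU1 S j : j \notin S -> hafnian (j |: S) = \sum_(i in S) W i j * hafnian (S :\ i).
Proof.
move=> jS; rewrite (@hafnian_pivot _ j) ?setU11 // setU1K //.
by apply: eq_bigr => i _; rewrite WC.
Qed.
End Matchings.

(** * The recursion for the right-hand side *)

Section PieriSum.
Variables (n : nat) (A : pzRingType) (br P c : 'I_n -> 'I_n -> A) (f : {set 'I_n} -> A).
Implicit Types (S T U V W : {set 'I_n}) (i j k l a b d p : 'I_n).

Hypothesis brN : forall i j, i != j -> br j i = - br i j.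
Hypothesis br2 : forall i j, i != j -> br i j * br i j = c i j - P i j.
Hypothesis brC : forall i j k l, i != j -> k != l ->
  [disjoint [set i; j] & [set k; l]] -> br i j * br k l = br k l * br i j.
Hypothesis br3 : forall i j k, i != j -> j != k -> k != i ->
  br i j * br j k + br j k * br k i + br k i * br i j = 0.
Hypothesis brP : forall i j k l, i != j -> k != l ->
  br i j * P k l = P (tperm i j k) (tperm i j l) * br i j.
Hypothesis brc : forall i j k l, i != j -> br i j * c k l = c k l * br i j.
Hypothesis PC : forall i j, P i j = P j i.
Hypothesis f0 : f set0 = 1.
Hypothesis f_odd : forall S, odd #|S| -> f S = 0.
Hypothesis f_rec : forall j S, j \notin S -> f (j |: S) = \sum_(i in S) P i j * f (S :\ i).
Hypothesis f_P : forall i j S, i != j -> P i j * f S = f S * P i j.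
Hypothesis f_c : forall i j S, c i j * f S = f S * c i j.

Definition pieri_sum bs (I : {set 'I_n}) (k : nat) : A :=
  \sum_(S : {set 'I_n} | S \subset I) (#|S| == k)%:R * pieri br f bs S.

Lemma perm_pieri_sum bs bs' (I : {set 'I_n}) (k : nat) : perm_eq bs bs' -> uniq bs -> (forall b, b \in bs -> b \notin I) ->
  pieri_sum bs I k = pieri_sum bs' I k.
Proof.
move=> pbs ubs H; apply: eq_bigr => S SI; congr (_ * _).
by apply: perm_pieri => // b /H; apply: notin_sub.
Qed.

Lemma pieri0 bs : pieri br f bs set0 = 1.
Proof.
rewrite /pieri (bigD1 set0) ?sub0set //= setD0 f0 mul1r words0 big1 ?addr0 // => U.
by rewrite subset0 => /andP[/eqP ->]; rewrite eqxx.
Qed.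

Lemma pieri_sum_set0 bs (k : nat) : pieri_sum bs set0 k = (k == 0%N)%:R.
Proof.
rewrite /pieri_sum (bigD1 set0) ?sub0set //= cards0 eq_sym pieri0 mulr1 big1 ?addr0 // => U.
by rewrite subset0 => /andP[/eqP ->]; rewrite eqxx.
Qed.

Lemma pieri_sumU1 j (I : {set 'I_n}) bs (k : nat) : j \notin I -> uniq (j :: bs) ->
    (forall b, b \in bs = (b \notin j |: I)) ->
  pieri_sum bs (j |: I) k = pieri_sum (j :: bs) I k
    + (if k is k'.+1 then pieri_sum (j :: bs) I k' * dunkl br j else 0)
    + (if k is k''.+2 then \sum_(i in I) c i j * pieri_sum [:: i, j & bs] (I :\ i) k'' else 0).
Proof.
move=> jI /= /andP[jbs ubs] bsE.
have H b : b \in bs -> b \notin I by rewrite bsE inE negb_or => /andP[].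
have Hj b : b \in j :: bs -> b \notin I by rewrite inE => /orP[/eqP ->|/H].
rewrite /pieri_sum sum_subsetU1 //.
(* [pieri_step] solved for [pieri bs S], with the pairs [i \in S] renamed so that [i] lies outside
   the new set; this accounts for the successor in [#|S|.+1 == k]. *)
have -> : \sum_(S : {set 'I_n} | S \subset I) (#|S| == k)%:R * pieri br f bs S =
    \sum_(S : {set 'I_n} | S \subset I) (#|S| == k)%:R * pieri br f (j :: bs) S
  + \sum_(S : {set 'I_n} | S \subset I) (#|S|.+1 == k)%:R * (pieri br f (j :: bs) S * \sum_(i in I :\: S) br j i).
  rewrite [X in _ = _ + X](_ : _ = \sum_(S : {set 'I_n} | S \subset I) \sum_(i in S)
    (#|S| == k)%:R * (pieri br f (j :: bs) (S :\ i) * br j i)).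
    rewrite -big_split /=; apply: eq_bigr => S SI.
    have HS b : b \in j :: bs -> b \notin S by move=> /Hj; apply: notin_sub.
    rewrite pieri_step // mulrDr -mulr_sumr -addrA -mulrDr -[LHS]addr0; congr (_ + _).
    rewrite -big_split big1 ?mulr0 //= => i iS.
    have ij : i != j by apply: contraNneq jI => <-; apply: (subsetP SI).
    by rewrite (brN ij) mulrN subrr.
  under eq_bigr => S _ do rewrite !mulr_sumr.
  rewrite (sum_subset_notin I (fun i S => (#|S|.+1 == k)%:R * (pieri br f (j :: bs) S * br j i))).
  rewrite (sum_subset_in I (fun i S => (#|S| == k)%:R * (pieri br f (j :: bs) (S :\ i) * br j i))).
  apply: eq_bigr => i iI; apply: eq_bigr => S; rewrite subsetD1 => /andP[SI iS].
  by rewrite cardsU1 iS add1n setU1K.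
have dE S : S \subset I -> dunkl br j =
    \sum_(b <- bs) br j b + \sum_(i in S) br j i + \sum_(i in I :\: S) br j i.
  move=> SI; rewrite -addrA big_uniq //= /dunkl (bigID (mem I)) /= addrC; congr (_ + _).
    by apply: eq_bigl => b; rewrite bsE in_setU1 negb_or.
  have -> : \sum_(i in S) br j i = \sum_(i in I :&: S) br j i by rewrite (setIidPr SI).
  rewrite -big_setID; apply: eq_bigl => i.
  by case: (boolP (i \in I)) => iI; rewrite ?andbF // andbT; apply: contraNneq jI => <-.
rewrite -!addrA; congr (_ + _); rewrite -big_split /=.
have -> : (if k is k'.+1 then (\sum_(S : {set 'I_n} | S \subset I) (#|S| == k')%:R * pieri br f (j :: bs) S) * dunkl br j else 0)
   = \sum_(S : {set 'I_n} | S \subset I) (#|S|.+1 == k)%:R * (pieri br f (j :: bs) S * dunkl br j).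
  case: k => [|k]; first by rewrite big1 // => S _; rewrite mul0r.
  by rewrite mulr_suml; apply: eq_bigr => S _; rewrite eqSS mulrA.
have -> : (if k is k''.+2 then \sum_(i in I) c i j * (\sum_(S : {set 'I_n} | S \subset I :\ i) (#|S| == k'')%:R * pieri br f [:: i, j & bs] S) else 0)
   = \sum_(S : {set 'I_n} | S \subset I) (#|S|.+1 == k)%:R * \sum_(i in S) (c i j * pieri br f [:: i, j & bs] (S :\ i)).
  under [RHS]eq_bigr => S _ do rewrite mulr_sumr.
  rewrite (sum_subset_in I (fun i S => (#|S|.+1 == k)%:R * (c i j * pieri br f [:: i, j & bs] (S :\ i)))).
  have E i S : S \subset I :\ i -> (#|i |: S|.+1 == k)%:R * (c i j * pieri br f [:: i, j & bs] ((i |: S) :\ i))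
     = (#|S|.+2 == k)%:R * (c i j * pieri br f [:: i, j & bs] S).
    by rewrite subsetD1 => /andP[SI iS]; rewrite cardsU1 iS add1n setU1K.
  case: k E => [|[|k]] E.
  - by rewrite big1 // => i iI; rewrite big1 // => S /E ->; rewrite mul0r.
  - by rewrite big1 // => i iI; rewrite big1 // => S /E ->; rewrite mul0r.
  apply: eq_bigr => i iI; rewrite mulr_sumr; apply: eq_bigr => S /E ->.
  by rewrite !eqSS !mulrA delta_comm.
rewrite -big_split /=; apply: eq_bigr => S SI.
have jS := notin_sub SI jI.
rewrite cardsU1 jS add1n -!mulrDr; congr (_ * _).
rewrite (pieri_dunkl (P := P) (c := c)) //; last by move=> b /H; apply: notin_sub.
by rewrite (dE S SI) [_ * (_ + _ + _)]mulrDr addrCA addrA addrC addrA.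
Qed.

Lemma Edef_pieri (fuel : nat) (s : seq 'I_n) (k : nat) : uniq s -> (size s <= fuel)%N ->
  Edef (dunkl br) c fuel s k = pieri_sum (enum (~: [set i in s])) [set i in s] k.
Proof.
have base (k0 : nat) : (k0 == 0%N)%:R = pieri_sum (enum (~: [set i in [::]])) [set i in ([::] : seq 'I_n)] k0 :> A.
  by rewrite (_ : [set i in [::]] = set0) ?pieri_sum_set0 //; apply/setP => x; rewrite !inE.
elim: fuel s k => [|fuel IH] [|j s] k //=.
rewrite ltnS => /andP[js us] sf.
have -> : [set i in j :: s] = j |: [set i in s] by apply/setP => x; rewrite !inE.
set I := [set i in s]; have jI : j \notin I by rewrite inE.
set bs := enum (~: (j |: I)).
have bsE b : b \in bs = (b \notin j |: I) by rewrite mem_enum inE.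
have ubs : uniq (j :: bs) by rewrite /= bsE setU11 enum_uniq.
(* The enumeration of the complement of [I] has [j] at its sorted place, not in front. *)
have perm1 : perm_eq (enum (~: I)) (j :: bs).
  apply: uniq_perm; rewrite ?enum_uniq // => x.
  rewrite mem_enum !inE bsE !inE; case: (x =P j) => [->|//] /=.
  by rewrite -[j \in s]/(j \in s) js.
have E1 (k' : nat) : Edef (dunkl br) c fuel s k' = pieri_sum (j :: bs) I k'.
  rewrite IH //; apply: perm_pieri_sum; rewrite ?enum_uniq //.
  by move=> b; rewrite mem_enum inE.
have E2 i (k' : nat) : i \in s -> Edef (dunkl br) c fuel (rem i s) k' = pieri_sum [:: i, j & bs] (I :\ i) k'.
  move=> si; rewrite IH ?rem_uniq //; last first.
    by rewrite size_rem //; apply: leq_trans (leq_pred _) sf.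
  have -> : [set x in rem i s] = I :\ i by apply/setP => x; rewrite !inE mem_rem_uniq.
  apply: perm_pieri_sum; rewrite ?enum_uniq //; last by move=> b; rewrite mem_enum inE.
  have iI : i \in I by rewrite inE.
  apply: uniq_perm; rewrite ?enum_uniq //.
    rewrite cons_uniq ubs andbT inE negb_or bsE in_setU1 iI orbT /= andbT.
    by apply: contraNneq jI => <-.
  move=> x; rewrite mem_enum in_setC in_setD1 negb_and negbK [in RHS]in_cons -(perm_mem perm1) mem_enum in_setC.
  by [].
rewrite pieri_sumU1 // !E1; congr (_ + _ + _); first by case: k => // k; rewrite E1.
case: k => [|[|k]] //; rewrite (big_uniq _ us) /=.
by apply: eq_big => [i|i si]; rewrite ?inE // E2.
Qed.

Theorem Eset_pieri (I : {set 'I_n}) (k : nat) :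
  Eset (dunkl br) c I k
    = \sum_(l < (k %/ 2).+1)
        \sum_(I0 : {set 'I_n} | (I0 \subset I) && (#|I0| == 2 * l)%N)
          f I0 *
          \sum_(ab : {ffun 'I_(k - 2 * l) -> 'I_n * 'I_n} | star_seq I I0 ab)
             \prod_(t < k - 2 * l) br (ab t).1 (ab t).2.
Proof.
rewrite /Eset Edef_pieri ?enum_uniq ?cardE // set_enum.
rewrite /pieri_sum /pieri; under eq_bigr => S _ do rewrite mulr_sumr.
transitivity (\sum_(S : {set 'I_n} | S \subset I) \sum_(U : {set 'I_n} | U \subset S)
   (#|U| + #|S :\: U| == k)%:R * (f U * words br (enum (~: I)) (S :\: U))).
  apply: eq_bigr => S _; apply: eq_bigr => U US; congr (_%:R * _).
  by rewrite -(cardsID U S) (setIidPr US).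
(* The sum is regrouped by [U], in the role of [I0]; the inner set is the set of first indices. *)
rewrite (sum_subsetA I (fun U V W => (#|U| + #|V| == k)%:R * (f U * words br (enum (~: I)) V))).
under [RHS]eq_bigr => l _ do rewrite big_mkcondr.
rewrite exchange_big /=; apply: eq_bigr => U UI.
rewrite -big_mkcond /=.
have [oU|eU] := boolP (odd #|U|).
  rewrite big1 => [|V _]; last by rewrite f_odd // mul0r mulr0.
  by rewrite big1 // => l _; rewrite f_odd // mul0r.
have cU : #|U| = (2 * #|U|./2)%N by rewrite -[LHS]odd_double_half (negbTE eU) mul2n.
(* For a given [U] at most one [l] contributes, and none if [#|U|] exceeds [k]. *)
have Ul (l : nat) : (#|U| == 2 * l)%N = (l == #|U|./2).
  by rewrite {1}cU eqn_mul2l eq_sym.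
have [Uk|kU] := leqP #|U| k.
  have lk : (#|U|./2 < (k %/ 2).+1)%N by rewrite ltnS -divn2 leq_div2r.
  rewrite (big_pred1 (Ordinal lk)) => [|l] /=; last by rewrite Ul.
  rewrite sum_star_seq mulr_sumr -cU; apply: eq_bigr => V _.
  rewrite -{1}(subnKC Uk) eqn_add2l.
  by rewrite mulrA -delta_comm mulrA.
rewrite big1 => [|V _]; last first.
  by rewrite gtn_eqF ?mul0r //; apply: leq_trans kU (leq_addr _ _).
rewrite big_pred0 // => l; rewrite Ul; apply/negP => /eqP E.
have := ltn_ord l; rewrite E ltnS -divn2 leqNgt => /negP; apply.
by rewrite ltn_divLR // divn2 muln2 -mul2n -cU.
Qed.
End PieriSum.

From mathcomp Require Import all_classical all_reals all_analysis.
Import Order.TTheory GRing.Theory Num.Theory.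
Import numFieldNormedType.Exports.
Local Open Scope ring_scope.

(** * Meromorphy of the Weierstrass function *)

Section ComplexNorm.
Variable R : realType.
Implicit Types z w : R[i].

(* The norm of R[i] takes values in the partially ordered field R[i] itself;
   [nm] is the modulus as an element of R. *)
Definition nm z : R := complex.Re `|z|.

Lemma gtc0_real z : 0 < z -> z = (complex.Re z)%:C%C /\ 0 < complex.Re z.
Proof. by case: z => a b; rewrite ltcE /= => /andP[/eqP ->]. Qed.

Lemma nmE z : `|z| = (nm z)%:C%C.
Proof. by rewrite /nm normc_def. Qed.

Lemma nm_ge0 z : 0 <= nm z.
Proof. by have := normr_ge0 z; rewrite nmE lecR. Qed.

Lemma nm_eq0 z : (nm z == 0) = (z == 0).
Proof. by rewrite -[RHS]normr_eq0 nmE -(inj_eq (@complexI R)). Qed.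

Lemma nm_gt0 z : (0 < nm z) = (z != 0).
Proof. by rewrite lt_def nm_ge0 andbT nm_eq0. Qed.

Lemma nmD z w : nm (z + w) <= nm z + nm w.
Proof. by have := ler_normD z w; rewrite !nmE -rmorphD lecR. Qed.

Lemma nmM z w : nm (z * w) = nm z * nm w.
Proof. by apply: (@complexI R); rewrite rmorphM -!nmE normrM. Qed.

Lemma nmN z : nm (- z) = nm z.
Proof. by rewrite /nm normrN. Qed.

Lemma nmB z w : nm (z - w) <= nm z + nm w.
Proof. by rewrite -(nmN w) nmD. Qed.

Lemma nm0 : nm 0 = 0.
Proof. by apply/eqP; rewrite nm_eq0. Qed.

Lemma nm1 : nm 1 = 1.
Proof. by rewrite /nm normr1. Qed.

Lemma nmV z : nm z^-1 = (nm z)^-1.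
Proof. by apply: (@complexI R); rewrite fmorphV -!nmE normfV. Qed.

Lemma nmX z k : nm (z ^+ k) = nm z ^+ k.
Proof. by elim: k => [|k IH]; rewrite ?nm1 // !exprS nmM IH. Qed.

Lemma nm_real (x : R) : nm x%:C%C = `|x|.
Proof. by rewrite /nm normc_def /= expr0n /= addr0 sqrtr_sqr. Qed.

Lemma nm_nat k : nm k%:R = k%:R.
Proof. by rewrite -(rmorph_nat (@real_complex R)) nm_real normr_nat. Qed.

Lemma nm_ge_Im z : `|complex.Im z| <= nm z.
Proof.
rewrite /nm normc_def /= -sqrtr_sqr ler_sqrt ?lerDr ?sqr_ge0 //.
by rewrite addr_ge0 ?sqr_ge0.
Qed.

Lemma nm_ge_Re z : `|complex.Re z| <= nm z.
Proof.
rewrite /nm normc_def /= -sqrtr_sqr ler_sqrt ?lerDl ?sqr_ge0 //.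
by rewrite addr_ge0 ?sqr_ge0.
Qed.

Lemma nm_le_ReIm z : nm z <= `|complex.Re z| + `|complex.Im z|.
Proof.
case: z => a b; have -> : (a +i* b)%C = a%:C%C + 'i%C * b%:C%C.
  by apply/eqP; rewrite eq_complex /= !(mul0r, mul1r, mulr0, add0r, subr0, addr0) !eqxx.
apply: le_trans (nmD _ _) _; rewrite nmM !nm_real /=.
have -> : nm 'i%C = 1 by rewrite /nm normc_def /= expr0n expr1n add0r sqrtr1.
by rewrite !(mul0r, mul1r, mulr0, add0r, subr0, addr0).
Qed.

Lemma nm_sum (I : Type) (r : seq I) (F : I -> R[i]) :
  nm (\sum_(i <- r) F i) <= \sum_(i <- r) nm (F i).
Proof.
elim: r => [|i r IH]; first by rewrite !big_nil nm0.
by rewrite !big_cons; apply: le_trans (nmD _ _) _; rewrite lerD2l.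
Qed.

Definition nmcvg (u : nat -> R[i]) (l : R[i]) :=
  forall e : R, 0 < e -> exists N, forall k, (N <= k)%N -> nm (u k - l) < e.

Lemma nmcvgD u v l m : nmcvg u l -> nmcvg v m -> nmcvg (fun k => u k + v k) (l + m).
Proof.
move=> ul vm e e0; have e2 : 0 < e / 2 by rewrite divr_gt0.
have [N1 H1] := ul _ e2; have [N2 H2] := vm _ e2; exists (maxn N1 N2) => k.
rewrite geq_max => /andP[/H1 h1 /H2 h2]; rewrite [e]splitr.
by rewrite opprD addrACA; apply: le_lt_trans (nmD _ _) (ltrD h1 h2).
Qed.

Lemma nmcvgZ u l a : nmcvg u l -> nmcvg (fun k => a * u k) (a * l).
Proof.
move=> ul e e0; have a0 : 0 < nm a + 1 by rewrite ltr_wpDl ?nm_ge0.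
have [N H] := ul _ (divr_gt0 e0 a0); exists N => k /H h.
rewrite -mulrBr nmM; have := h; rewrite ltr_pdivlMr // => h'.
by apply: le_lt_trans h'; rewrite mulrC ler_wpM2l ?nm_ge0 // lerDl.
Qed.

Lemma nmcvg_le u l B : nmcvg u l -> (forall k, nm (u k) <= B) -> nm l <= B.
Proof.
move=> ul H; apply/ler_addgt0Pr => e e0; have [N /(_ N (leqnn N)) h] := ul _ e0.
have -> : l = u N - (u N - l) by rewrite subKr.
by apply: le_trans (nmB _ _) _; apply: lerD; rewrite ?H // ltW.
Qed.

Definition dN (N : nat) : R := N.+1%:R^-1.

(* Up to the constant, the bound |u_(N+1) - u_N| = O(1/N^2). *)
Definition telescoping (u : nat -> R[i]) (B : R) :=
  forall N, nm (u N.+1 - u N) <= B * (dN N - dN N.+1).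

Lemma dN_gt0 N : 0 < dN N.
Proof. by rewrite invr_gt0 ltr0n. Qed.

(** [x N - B * dN N] is nondecreasing and [x N + B * dN N] nonincreasing, so the former is bounded
    and converges, and [B * dN N] tends to 0. *)
Lemma real_telescoping (x : nat -> R) (B : R) : 0 <= B ->
  (forall N, `|x N.+1 - x N| <= B * (dN N - dN N.+1)) -> cvgn x.
Proof.
move=> B0 H.
have step N : x N - B * dN N <= x N.+1 - B * dN N.+1 /\ x N.+1 + B * dN N.+1 <= x N + B * dN N.
  by have := H N; rewrite ler_norml => /andP[]; split; lra.
have bnd N : x N + B * dN N <= x 0%N + B * dN 0.
  by elim: N => // N IH; have [_] := step N => h; apply: le_trans h IH.
have c1 : cvgn (fun N => x N - B * dN N).
  apply: nondecreasing_is_cvgn.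
    by apply/nondecreasing_seqP => N; have [] := step N.
  exists (x 0%N + B * dN 0) => _ [N _ <-]; apply: le_trans (bnd N).
  by have := mulr_ge0 B0 (ltW (dN_gt0 N)); lra.
have c2 : cvgn dN by apply/cvg_ex; exists 0; exact: cvg_harmonic.
have c3 : cvgn (fun N => B * dN N).
  by move/cvg_ex: c2 => [l cl]; apply/cvg_ex; exists (B * l); apply: cvgMr.
rewrite (_ : x = (fun N => x N - B * dN N) \+ (fun N => B * dN N)).
  exact: is_cvgD.
by apply/funext => N /=; rewrite subrK.
Qed.

Lemma telescoping_nmcvg u B : 0 <= B -> telescoping u B -> exists l, nmcvg u l.
Proof.
move=> B0 H.
have /cvg_ex[a /cvgrPdist_lt ua] : cvgn (fun N => complex.Re (u N)).
  apply: (real_telescoping B0) => N; apply: le_trans (H N).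
  by apply: le_trans (nm_ge_Re _); case: (u N.+1) (u N) => [? ?] [? ?].
have /cvg_ex[b /cvgrPdist_lt ub] : cvgn (fun N => complex.Im (u N)).
  apply: (real_telescoping B0) => N; apply: le_trans (H N).
  by apply: le_trans (nm_ge_Im _); case: (u N.+1) (u N) => [? ?] [? ?].
exists (a +i* b)%C => e e0; have e2 : 0 < e / 2 by rewrite divr_gt0.
have [N1 _ H1] := ua _ e2; have [N2 _ H2] := ub _ e2; exists (maxn N1 N2) => k.
rewrite geq_max => /andP[/H1 h1 /H2 h2]; rewrite [e]splitr.
apply: le_lt_trans (nm_le_ReIm _) _; move: h1 h2 => /=; case: (u k) => x y /= h1 h2.
by apply: ltrD; rewrite distrC.
Qed.

(** The bound is uniform in [N] and so survives in the limit: Taylor estimates of single terms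
    become an estimate of the tail. *)
Lemma telescoping_le u B : telescoping u B -> 0 <= B -> forall N, nm (u N - u 0%N) <= B.
Proof.
move=> H B0 N; have : nm (u N - u 0%N) <= B * (dN 0 - dN N).
  elim: N => [|N IH]; first by rewrite !subrr nm0 mulr0.
  rewrite -(subrKA (u N)); apply: le_trans (nmD _ _) _.
  by have := H N; move: IH; rewrite !mulrBr; lra.
move=> h; apply: le_trans h _; rewrite -[leRHS]mulr1; apply: ler_wpM2l => //.
have := dN_gt0 N; have -> : dN 0 = 1 by rewrite /dN invr1.
lra.
Qed.
End ComplexNorm.

(** * Square partial sums over the lattice *)

Section LatticeSums.
Variables (R : realType) (tau : R[i]).
Implicit Types (z w h : R[i]) (t : R[i] -> R[i]) (N : nat).

Definition lat N (a b : nat) : R[i] := (a%:R - N%:R) + (b%:R - N%:R) * tau.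

(** The summation of [wp_partial] with an arbitrary term, so that the terms of the series, their
    derivatives and their Taylor remainders share one estimate. *)
Definition latsum t N : R[i] :=
  \sum_(a < (N + N).+1) \sum_(b < (N + N).+1)
    (if ((a : nat) != N) || ((b : nat) != N) then t (lat N a b) else 0).

Lemma latsumD t1 t2 N : latsum (fun w => t1 w + t2 w) N = latsum t1 N + latsum t2 N.
Proof.
rewrite /latsum -big_split; apply: eq_bigr => a _; rewrite -big_split; apply: eq_bigr => b _ /=.
by case: ifP; rewrite ?addr0.
Qed.

Lemma latsumZ x t N : latsum (fun w => x * t w) N = x * latsum t N.
Proof.
rewrite /latsum mulr_sumr; apply: eq_bigr => a _; rewrite mulr_sumr; apply: eq_bigr => b _ /=.
by case: ifP; rewrite ?mulr0.
Qed.

(** The (2N+3)^2 - (2N+1)^2 = 8(N+1) new points form the boundary of the larger square. Indices are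
    centred, so inner points keep their lattice vector when both indices are raised by one. *)
Lemma latsum_step t N (B : R) : 0 <= B ->
  (forall a b, (a == 0)%N || (a == (N + N).+2) || (b == 0)%N || (b == (N + N).+2) ->
     (a <= (N + N).+2)%N -> (b <= (N + N).+2)%N -> nm (t (lat N.+1 a b)) <= B) ->
  nm (latsum t N.+1 - latsum t N) <= N.+1%:R * 8 * B.
Proof.
move=> B0 H.
pose g a b := if ((a : nat) != N.+1) || ((b : nat) != N.+1) then t (lat N.+1 a b) else 0.
have split2 (G : nat -> R[i]) : \sum_(a < (N.+1 + N.+1).+1) G a =
    G 0%N + G (N + N).+2 + \sum_(a < (N + N).+1) G a.+1.
  rewrite big_ord_recl addSn addnS big_ord_recr /= -addrA [X in _ + X]addrC.
  by rewrite addrA; congr (_ + _).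
have E : latsum t N.+1 = (\sum_(b < (N.+1 + N.+1).+1) g 0%N b + \sum_(b < (N.+1 + N.+1).+1) g (N + N).+2 b)
    + (\sum_(a < (N + N).+1) (g a.+1 0%N + g a.+1 (N + N).+2) + latsum t N).
  rewrite /latsum (split2 (fun a => \sum_(b < (N.+1 + N.+1).+1) g a b)); congr (_ + _).
  rewrite -big_split; apply: eq_bigr => a _ /=; rewrite (split2 (g a.+1)); congr (_ + _).
  apply: eq_bigr => b _; rewrite /g !eqSS; case: ifP => // _; congr t.
  by rewrite /lat -!natr1; congr (_ + _ * _); ring.
have gB a b : (a == 0)%N || (a == (N + N).+2) || (b == 0)%N || (b == (N + N).+2) ->
     (a <= (N + N).+2)%N -> (b <= (N + N).+2)%N -> nm (g a b) <= B.
  by rewrite /g => H1 H2 H3; case: ifP => _; rewrite ?nm0 // H.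
have sumB m (F : 'I_m -> R[i]) (C : R) : (forall i, nm (F i) <= C) -> nm (\sum_(i < m) F i) <= m%:R * C.
  move=> FC; apply: le_trans (nm_sum _ _) _.
  apply: le_trans (ler_sum _ (fun i _ => FC i)) _.
  by rewrite sumr_const card_ord mulr_natl.
have le2 (i : 'I_(N.+1 + N.+1).+1) : (i <= (N + N).+2)%N.
  by case: i => i /=; rewrite ltnS addSn addnS.
have lt2 (i : 'I_(N + N).+1) : (i < (N + N).+2)%N by apply: ltn_trans (ltn_ord i) _.
rewrite E addrA addrK.
have h1 : nm (\sum_(b < (N.+1 + N.+1).+1) g 0%N b) <= (N.+1 + N.+1).+1%:R * B.
  by apply: sumB => b; apply: gB; rewrite ?eqxx ?orbT // le2.
have h2 : nm (\sum_(b < (N.+1 + N.+1).+1) g (N + N).+2 b) <= (N.+1 + N.+1).+1%:R * B.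
  by apply: sumB => b; apply: gB; rewrite ?eqxx ?orbT // le2.
have h3 : nm (\sum_(a < (N + N).+1) (g a.+1 0%N + g a.+1 (N + N).+2)) <= (N + N).+1%:R * (B + B).
  apply: sumB => a; apply: le_trans (nmD _ _) _; apply: lerD; apply: gB; rewrite ?eqxx ?orbT //; exact: lt2.
apply: le_trans (nmD _ _) _.
apply: le_trans (lerD (nmD _ _) h3) _.
apply: le_trans (lerD (lerD h1 h2) (lexx _)) _.
rewrite -!natr1 !natrD -!natr1.
have : (N%:R : R) = N%:R by []. move: (N%:R : R) => x _.
by rewrite le_eqVlt; apply/orP; left; apply/eqP; ring.
Qed.

Hypothesis tau_im : 0 < complex.Im tau.

(** For w = x + y tau one has |y| <= |w| / Im tau and |x| <= |w| + |y| |tau|; the constant adds up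
    the two bounds. *)
Definition latM : R := 1 + (1 + nm tau) / complex.Im tau.

Lemma latM_gt0 : 0 < latM.
Proof. by rewrite ltr_wpDr // divr_ge0 ?addr_ge0 ?nm_ge0 // ltW. Qed.

Lemma lat_lower (x y : R) : `|x| + `|y| <= latM * nm (x%:C%C + y%:C%C * tau).
Proof.
set w := (X in nm X).
have Imw : complex.Im w = y * complex.Im tau by rewrite /w; case: tau => a b /=; ring.
have hy : `|y| <= nm w / complex.Im tau.
  rewrite ler_pdivlMr // -[X in _ * X]gtr0_norm // -normrM -Imw; exact: nm_ge_Im.
have hx : `|x| <= nm w + `|y| * nm tau.
  have -> : `|x| = nm (w - y%:C%C * tau) by rewrite /w addrK nm_real.
  by apply: le_trans (nmB _ _) _; rewrite nmM nm_real.
have hyt : `|y| * nm tau <= nm w / complex.Im tau * nm tau by rewrite ler_wpM2r ?nm_ge0.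
rewrite /latM (_ : _ * nm w = nm w + nm w / complex.Im tau * nm tau + nm w / complex.Im tau); first by lra.
by ring.
Qed.

Lemma lat_shell N a b : (a == 0)%N || (a == (N + N).+2) || (b == 0)%N || (b == (N + N).+2) ->
  N.+1%:R <= latM * nm (lat N.+1 a b).
Proof.
have -> : lat N.+1 a b = (a%:R - N.+1%:R)%:C%C + (b%:R - N.+1%:R)%:C%C * tau.
  by rewrite /lat !rmorphB !rmorph_nat.
move=> H; apply: le_trans (lat_lower _ _).
have far c : (c == 0)%N || (c == (N + N).+2) -> `|c%:R - N.+1%:R : R| = N.+1%:R.
  move=> /orP[] /eqP ->; first by rewrite sub0r normrN normr_nat.
  by rewrite -addSn -addnS natrD addrK normr_nat.
move: H; rewrite -orbA => /orP[/far ->|/far ->].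
  by rewrite lerDl.
by rewrite lerDr.
Qed.

Lemma latsum_bound t N (B : R) : 0 <= B ->
  (forall w, N.+1%:R <= latM * nm w -> nm (t w) <= B) ->
  nm (latsum t N.+1 - latsum t N) <= N.+1%:R * 8 * B.
Proof. by move=> B0 H; apply: latsum_step => // a b ab _ _; apply/H/lat_shell. Qed.

(** With m = N + N0, the 8(m+1) points of the shell satisfy |w| >= (m+1) / latM, so a step is at
    most 8 C latM^3 / (m+1)^2. The other factor 2 of the constant 16 comes from x(x+1) <= 2y^2 for 1
    <= x <= y. The shift by [N0] skips the points where the cubic bound is not assumed. *)
Lemma latsum_telescoping t (C : R) (N0 : nat) : 0 <= C ->
  (forall w, N0.+1%:R <= latM * nm w -> nm (t w) <= C / nm w ^+ 3) ->
  telescoping (fun N => latsum t (N + N0)) (16 * C * latM ^+ 3).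
Proof.
move=> C0 H N; set m := (N + N0)%N.
have M0 := latM_gt0; have m0 : 0 < m.+1%:R :> R by rewrite ltr0n.
rewrite addSn -/m; apply: le_trans (@latsum_bound _ _ (C * (latM / m.+1%:R) ^+ 3) _ _) _.
- by rewrite mulr_ge0 // exprn_ge0 // divr_ge0 // ltW.
- move=> w mw; have w0 : 0 < nm w.
    by rewrite -(pmulr_rgt0 _ M0); apply: lt_le_trans mw.
  apply: le_trans (H _ _) _.
    by apply: le_trans mw; rewrite ler_nat ltnS leq_addl.
  apply: ler_wpM2l => //; rewrite -exprVn; apply: lerXn2r.
  + by rewrite nnegrE invr_ge0 ltW.
  + by rewrite nnegrE divr_ge0 // ltW.
  + by rewrite -[leLHS]mul1r ler_pdivrMr // mulrAC ler_pdivlMr // mul1r.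
rewrite -/(dN R N) /dN.
have n0 : 0 < N.+1%:R :> R by rewrite ltr0n.
have nm1 : N.+1%:R <= m.+1%:R :> R by rewrite ler_nat ltnS leq_addr.
have n1 : 1 <= N.+1%:R :> R by rewrite ler1n.
rewrite -(natr1 N.+1).
move: (N.+1%:R : R) (m.+1%:R : R) n0 m0 nm1 n1 => x y x0 y0 xy x1.
have -> : y * 8 * (C * (latM / y) ^+ 3) = (8 * C * latM ^+ 3) * y^-1 ^+ 2.
  by field; rewrite gt_eqF.
have -> : 16 * C * latM ^+ 3 * (x^-1 - (x + 1)^-1) = (8 * C * latM ^+ 3) * (2 / (x * (x + 1))).
  by field; rewrite !gt_eqF //; lra.
apply: ler_wpM2l; first by rewrite mulr_ge0 ?mulr_ge0 ?exprn_ge0 // ltW.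
have xx : 0 < x * (x + 1) by rewrite mulr_gt0 //; lra.
rewrite ler_pdivlMr // exprVn mulrC ler_pdivrMr ?exprn_gt0 //.
have : x * (x + 1) <= y * (y + y) by apply: ler_pM; lra.
by rewrite expr2; lra.
Qed.
End LatticeSums.

(** * Holomorphy of the tail of the series *)

Section WeierstrassTail.
Variables (R : realType) (tau : R[i]).
Hypothesis tau_im : 0 < complex.Im tau.
Implicit Types (z w h : R[i]) (N : nat).

Lemma nmcvg_lim (u : nat -> Cx R) l N0 : nmcvg (fun N => u (N + N0)%N) l -> limn u = l.
Proof.
move=> ul; apply/(@cvg_lim (Cx R)); first exact: norm_hausdorff.
rewrite -(@cvg_shiftn N0); apply/cvgrPdist_lt => e e0.
have [eE re0] := gtc0_real e0.
have [N H] := ul _ re0.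
exists N => // k /= /H; rewrite distrC eE nmE ltcR.
exact.
Qed.

Definition wterm z w : R[i] := (z - w) ^- 2 - w ^- 2.
Definition wterm' z w : R[i] := - 2 * (z - w) ^- 3.

Lemma wp_partialE z N : wp_partial tau z N = latsum tau (wterm z) N.
Proof. by []. Qed.

Section Bounds.
Variable (r : R).
Hypothesis r0 : 0 < r.

(** For |z| <= r the second conjunct gives |z - w| >= |w| / 2; the third lets a factor 1/|w| be
    dropped in the Taylor bound. *)
Definition far w := (0 < nm w) && (2 * r <= nm w) && (1 <= nm w).

Lemma far_lower z w : far w -> nm z <= r -> (z - w != 0) * (w != 0) *
  (2 / nm w >= (nm (z - w))^-1) * (nm (z - w) <= 3 / 2 * nm w).
Proof.
move=> /andP[/andP[w0 w2r] w1] zr.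
have h1 : nm w / 2 <= nm (z - w).
  have : nm w <= nm z + nm (z - w) by rewrite -{1}(subKr z w) nmB.
  by lra.
have h2 : nm (z - w) <= 3 / 2 * nm w by have := nmB z w; lra.
have u0 : 0 < nm (z - w) by lra.
do !split => //; rewrite -?nm_gt0 //.
by rewrite -[2 / nm w]invf_div lef_pV2 // posrE // divr_gt0.
Qed.

(** The term equals z(2w - z) / ((z - w)^2 w^2), where |2w - z| <= 5/2 |w| and |z - w| >= |w| / 2;
    hence 10 = 5/2 * 4. *)
Lemma wterm_bound z w : far w -> nm z <= r -> nm (wterm z w) <= 10 * r / nm w ^+ 3.
Proof.
move=> fw zr; have [[[u0 w0] uV] uu] := far_lower fw zr.
have wpos : 0 < nm w by rewrite nm_gt0.
have -> : wterm z w = z * (2 * w - z) * ((z - w)^-1 ^+ 2 * w^-1 ^+ 2).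
  by rewrite /wterm; field; rewrite w0 u0.
rewrite nmM (nmM z) (nmM (_ ^+ 2)) !nmX !nmV.
have uV0 : 0 <= (nm (z - w))^-1 by rewrite invr_ge0 nm_ge0.
have h1 : nm (2 * w - z) <= 5 / 2 * nm w.
  have := nmB (2 * w) z; rewrite nmM nm_nat.
  by move: fw => /andP[/andP[_ ?] _]; lra.
have -> : 10 * r / nm w ^+ 3 = r * (5 / 2 * nm w) * ((2 / nm w) ^+ 2 * (nm w)^-1 ^+ 2).
  by field; rewrite gt_eqF.
apply: ler_pM; rewrite ?mulr_ge0 ?nm_ge0 ?exprn_ge0 ?invr_ge0 ?nm_ge0 //.
  by apply: ler_pM; rewrite ?nm_ge0.
apply: ler_wpM2r; first by rewrite exprn_ge0 // invr_ge0 ltW.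
by apply: lerXn2r; rewrite ?nnegrE // divr_ge0 // ltW.
Qed.

Lemma wterm'_bound z w : far w -> nm z <= r -> nm (wterm' z w) <= 16 / nm w ^+ 3.
Proof.
move=> fw zr; have [[[u0 w0] uV] uu] := far_lower fw zr.
have wpos : 0 < nm w by rewrite nm_gt0.
rewrite /wterm' nmM nmN nm_nat nmV nmX.
have -> : 16 / nm w ^+ 3 = 2 * (2 / nm w) ^+ 3 by field; rewrite gt_eqF.
apply: ler_wpM2l => //; rewrite -exprVn; apply: lerXn2r => //.
  by rewrite nnegrE invr_ge0 nm_ge0.
by rewrite nnegrE divr_ge0 // ltW.
Qed.

(** With u = z - w and v = u + h the remainder is h^2 (u + 2v) / (u^3 v^2). Since |u + 2v| <= 9/2
    |w|, the constant is 144 = 9/2 * 2^5. *)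
Lemma wterm_taylor z h w : far w -> nm z <= r -> nm (z + h) <= r ->
  nm (wterm (z + h) w - wterm z w - h * wterm' z w) <= 144 * nm h ^+ 2 / nm w ^+ 3.
Proof.
move=> fw zr zhr; have [[[u0 w0] uV] uu] := far_lower fw zr.
have [[[v0 _] vV] vv] := far_lower fw zhr.
have wpos : 0 < nm w by rewrite nm_gt0.
have w1 : 1 <= nm w by case/andP: fw.
have -> : wterm (z + h) w - wterm z w - h * wterm' z w =
    h ^+ 2 * ((z - w) + 2 * (z + h - w)) * ((z - w)^-1 ^+ 3 * (z + h - w)^-1 ^+ 2).
  rewrite /wterm /wterm'; move: u0 v0; have -> : z + h - w = (z - w) + h by ring.
  by move: (z - w) => u u0 v0; field; rewrite u0 v0 w0.
rewrite nmM (nmM (h ^+ 2)) (nmM (_ ^+ 3)) !nmX !nmV.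
have h1 : nm (z - w + 2 * (z + h - w)) <= 9 / 2 * nm w.
  by apply: le_trans (nmD _ _) _; rewrite nmM nm_nat; lra.
have uV0 : 0 <= (nm (z - w))^-1 by rewrite invr_ge0 nm_ge0.
have vV0 : 0 <= (nm (z + h - w))^-1 by rewrite invr_ge0 nm_ge0.
have iw0 : 0 <= 2 / nm w by rewrite divr_ge0 // ltW.
apply: (@le_trans _ _ (nm h ^+ 2 * (9 / 2 * nm w) * ((2 / nm w) ^+ 3 * (2 / nm w) ^+ 2))).
  apply: ler_pM; rewrite ?mulr_ge0 ?exprn_ge0 ?nm_ge0 //.
    by apply: ler_wpM2l; rewrite ?exprn_ge0 ?nm_ge0.
  by apply: ler_pM; rewrite ?exprn_ge0 //; apply: lerXn2r; rewrite ?nnegrE.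
have -> : nm h ^+ 2 * (9 / 2 * nm w) * ((2 / nm w) ^+ 3 * (2 / nm w) ^+ 2) =
   144 * nm h ^+ 2 / nm w ^+ 3 * (nm w)^-1 by field; rewrite gt_eqF.
rewrite ler_piMr ?invf_le1 // divr_ge0 ?mulr_ge0 ?exprn_ge0 ?nm_ge0 //.
Qed.
End Bounds.

Lemma wp_tail (r : R) : 0 < r -> exists N0 (T : Cx R -> Cx R),
  (forall z : Cx R, wp tau z = z ^- 2 + wp_partial tau z N0 + T z) /\
  (forall z : Cx R, nm z < r -> differentiable T z).
Proof.
move=> r0; have M0 := latM_gt0 tau_im; set M := latM tau in M0.
(* With this [N0], all lattice points outside the square satisfy |w| >= 2r + 1 and are therefore
   [far]. *)
have [N0 HN0] : exists N0 : nat, M * (2 * r + 1) <= N0.+1%:R.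
  exists (Num.bound (M * (2 * r + 1))).
  have h : 0 <= M * (2 * r + 1) by rewrite mulr_ge0 //; lra.
  by apply: ltW; apply: lt_le_trans (archi_boundP h) _; rewrite ler_nat.
have farP w : N0.+1%:R <= M * nm w -> far r w.
  move=> /(le_trans HN0); rewrite ler_pM2l // => h.
  by apply/andP; split; [apply/andP; split|]; lra.
(* Defining the tail by subtraction makes the decomposition an identity at every [z], lattice points
   included. *)
exists N0, (fun z => limn (wp_partial tau z) - wp_partial tau z N0); split.
  by move=> z; rewrite /wp -addrA addrC [_ + (_ - _)]addrC subrK addrC.
move=> z0 zr0; pose z : R[i] := z0; rewrite -[z0]/z.
have zr : nm z < r by exact: zr0.
have zr' := ltW zr.
have tel1 y : nm y <= r -> telescoping (fun N => latsum tau (wterm y) (N + N0)) (16 * (10 * r) * M ^+ 3).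
  move=> yr; apply: latsum_telescoping => //; first by rewrite mulr_ge0 // ltW.
  by move=> w /farP fw; apply: wterm_bound.
have tel2 : telescoping (fun N => latsum tau (wterm' z) (N + N0)) (16 * 16 * M ^+ 3).
  by apply: latsum_telescoping => // w /farP fw; apply: (@wterm'_bound r).
have lim1 y : nm y <= r -> nmcvg (fun N => latsum tau (wterm y) (N + N0)) (limn (wp_partial tau y)).
  move=> yr; have [|l yl] := telescoping_nmcvg _ (tel1 y yr).
    by rewrite !mulr_ge0 // ?exprn_ge0 // ltW.
  by rewrite (nmcvg_lim (N0 := N0) (l := l)).
have [|D lim2] := telescoping_nmcvg _ tel2.
  by rewrite !mulr_ge0 // ?exprn_ge0 // ltW.
set T := fun x => _; set D0 := D - latsum tau (wterm' z) N0.
pose C := 16 * 144 * M ^+ 3.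
have C0 : 0 <= C by rewrite !mulr_ge0 // ?exprn_ge0 // ltW.
(* The remainders of single terms satisfy the cubic bound with constant [144 * nm h ^+ 2]. Their
   partial sums outside the square [N0] are thus bounded uniformly, and the bound passes to the
   limit. *)
have taylor (h : R[i]) : nm (z + h) <= r -> nm (T (z + h) - T z - h * D0) <= C * nm h ^+ 2.
  move=> zhr; pose t w := wterm (z + h) w - wterm z w - h * wterm' z w.
  have tE N : latsum tau t N = latsum tau (wterm (z + h)) N - latsum tau (wterm z) N - h * latsum tau (wterm' z) N.
    have -> : t = (fun w => wterm (z + h) w + (-1 * wterm z w + - h * wterm' z w)).
      by apply/funext => w; rewrite /t mulN1r mulNr addrA.
    by rewrite (latsumD _ (wterm (z + h))) (latsumD _ (fun w => -1 * wterm z w)) (latsumZ _ _ (wterm z)) (latsumZ _ _ (wterm' z)) mulN1r mulNr addrA.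
  have telt : telescoping (fun N => latsum tau t (N + N0)) (16 * (144 * nm h ^+ 2) * M ^+ 3).
    apply: latsum_telescoping => //; first by rewrite mulr_ge0 // exprn_ge0 ?nm_ge0.
    by move=> w /farP fw; exact: (@wterm_taylor r).
  apply: (@nmcvg_le _ (fun N => latsum tau t (N + N0) - latsum tau t (0 + N0))).
    have := nmcvgD (nmcvgD (lim1 _ zhr) (nmcvgZ (-1) (lim1 _ zr'))) (nmcvgZ (- h) lim2).
    move=> H e e0; have [N HN] := H e e0; exists N => k /HN; congr (nm _ < _).
    rewrite !tE add0n /T /D0 !wp_partialE.
    have rearr (a b c a0 b0 c0 la lb ld k' : R[i]) :
      a + -1 * b + - k' * c - (la + -1 * lb + - k' * ld) =
      a - b - k' * c - (a0 - b0 - k' * c0) - (la - a0 - (lb - b0) - k' * (ld - c0)) by ring.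
    exact: rearr.
  move=> N; rewrite [leRHS](_ : _ = 16 * (144 * nm h ^+ 2) * M ^+ 3); last by rewrite /C; ring.
  apply: (telescoping_le telt).
  by rewrite !mulr_ge0 // ?exprn_ge0 ?nm_ge0 // ltW.
apply/derivable1_diffP/cvg_ex; exists D0.
apply/cvgrPdist_le => e e0.
have [eE re0] := gtc0_real e0.
(* The first bound keeps [z + h] in the disc of radius [r], the second makes [C * nm h] smaller than
   the given error; [C + 1] is a positive denominator. *)
pose d := Num.min (r - nm z) (complex.Re e / (C + 1)).
have d0 : 0 < d by rewrite lt_min subr_gt0 zr divr_gt0 // ltr_wpDl.
have dC : 0 < d%:C%C :> R[i] by rewrite ltcR.
near=> h.
have h0 : h != 0 by near: h; exact: nbhs_dnbhs_neq.
have hd : nm h < d.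
  have : `|h| < d%:C%C by near: h; exact: dnbhs0_lt.
  by rewrite nmE ltcR.
move: hd; rewrite lt_min => /andP[hd1 hd2].
have zhr : nm (z + h) <= r by have := nmD z h; lra.
rewrite eE nmE lecR /= scaler1 /= [h + z]addrC.
have nh0 : 0 < nm h by rewrite nm_gt0.
have -> : D0 - h^-1 *: (T (z + h) - T z) = - (h^-1 * (T (z + h) - T z - h * D0)).
  have rearr (k x y : R[i]) : k != 0 -> y - k^-1 * x = - (k^-1 * (x - k * y)).
    by move=> k0; field.
  exact: rearr.
rewrite nmN nmM nmV ler_pdivrMl // (le_trans (taylor h zhr)) //.
rewrite expr2 mulrA mulrC; apply: ler_wpM2l; first exact: nm_ge0.
move: hd2; rewrite ltr_pdivlMr ?ltr_wpDl // => hd2.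
by apply: le_trans (ltW hd2); rewrite mulrC ler_wpM2l ?nm_ge0 // lerDl.
Unshelve. all: by end_near. Qed.

End WeierstrassTail.

(** * Local quotients of holomorphic functions *)

Section Quotients.
Variables (R : realType) (n : nat).
Local Open Scope classical_set_scope.
Implicit Types (f g h : Cn R n -> Cx R) (p x : Cn R n) (U V : set (Cn R n)).

(* Unlike [meromorphic], this asks the denominator to be nonzero on a dense set,
   so that sums and products need no identity theorem. *)
Definition quotient_at p f := exists U g h,
  [/\ open U /\ U p, (forall x, U x -> differentiable g x), (forall x, U x -> differentiable h x),
     (forall V, open V -> V !=set0 -> V `<=` U -> exists2 z, V z & h z != 0) &
     forall z, U z -> h z != 0 -> f z = g z / h z].

Lemma open_neq0 V h : open V -> (forall x, V x -> differentiable h x) ->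
  open (V `&` [set z | h z != 0]).
Proof.
move=> oV dh; rewrite openE => x [Vx hx]; apply: filterI.
  exact: open_nbhs_nbhs.
have /cvgr_neq0 := differentiable_continuous (dh x Vx).
exact.
Qed.

Lemma quotient_at_cst p (a : Cx R) : quotient_at p (fun _ => a).
Proof.
exists setT, (fun _ => a), (fun _ => 1); split.
- by split => //; exact: openT.
- by move=> x _; exact: differentiable_cst.
- by move=> x _; exact: differentiable_cst.
- by move=> V _ [z Vz] _; exists z => //; exact: oner_neq0.
- by move=> z _ _; rewrite divr1.
Qed.

Lemma quotient_at_holo p f U : open U -> U p -> (forall x, U x -> differentiable f x) ->
  quotient_at p f.
Proof.
move=> oU Up df; exists U, f, (fun _ => 1); split => //.
- by move=> V _ [z Vz] _; exists z => //; exact: oner_neq0.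
- by move=> z _ _; rewrite divr1.
Qed.

Lemma quotient_at2 p f1 f2 (F : Cx R -> Cx R -> Cx R) (G : Cx R -> Cx R -> Cx R -> Cx R -> Cx R) :
  (forall g1 h1 g2 h2 x, differentiable (g1 : Cn R n -> Cx R) x -> differentiable (h1 : Cn R n -> Cx R) x ->
     differentiable (g2 : Cn R n -> Cx R) x -> differentiable (h2 : Cn R n -> Cx R) x ->
     differentiable (fun y => G (g1 y) (h1 y) (g2 y) (h2 y)) x) ->
  (forall a b c d : Cx R, b != 0 -> d != 0 -> F (a / b) (c / d) = G a b c d / (b * d)) ->
  quotient_at p f1 -> quotient_at p f2 -> quotient_at p (fun x => F (f1 x) (f2 x)).
Proof.
move=> dG FG [U1 [g1 [h1 [[oU1 U1p] dg1 dh1 H1 E1]]]] [U2 [g2 [h2 [[oU2 U2p] dg2 dh2 H2 E2]]]].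
exists (U1 `&` U2), (fun x => G (g1 x) (h1 x) (g2 x) (h2 x)), (fun x => h1 x * h2 x); split.
- by split => //; exact: openI.
- by move=> x [U1x U2x]; apply: dG; [exact: dg1|exact: dh1|exact: dg2|exact: dh2].
- by move=> x [U1x U2x]; apply: (@differentiableM _ _ h1 h2); [exact: dh1|exact: dh2].
(* [h1] is non-zero on a nonempty open part of [V], where the density condition for [h2] is then
   applied. *)
- move=> V oV [z0 Vz0] VU; have VU1 : V `<=` U1 by move=> z /VU [].
  have [z1 Vz1 h1z] := H1 V oV (ex_intro _ z0 Vz0) VU1.
  have oV' := @open_neq0 V h1 oV (fun x Vx => dh1 x (VU1 x Vx)).
  have [z2 [Vz2 h1z2] h2z] : exists2 z, (V `&` [set z | h1 z != 0]) z & h2 z != 0.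
    apply: (H2 _ oV'); first by exists z1.
    by move=> z [/VU []].
  by exists z2 => //; rewrite mulf_neq0.
- move=> z [U1z U2z]; rewrite mulf_eq0 negb_or => /andP[h1z h2z].
  by rewrite E1 // E2 // FG.
Qed.

Lemma quotient_atD p f1 f2 : quotient_at p f1 -> quotient_at p f2 ->
  quotient_at p (fun x => f1 x + f2 x).
Proof.
apply: (@quotient_at2 _ _ _ (fun a b => a + b) (fun a b c d => a * d + c * b)).
  move=> g1 h1 g2 h2 x d1 d2 d3 d4.
  apply: (@differentiableD _ _ _ (fun y => g1 y * h2 y) (fun y => g2 y * h1 y)).
    exact: (@differentiableM _ _ g1 h2).
  exact: (@differentiableM _ _ g2 h1).
by move=> a b c d b0 d0; exact: (@addf_div R[i]).
Qed.

Lemma quotient_atM p f1 f2 : quotient_at p f1 -> quotient_at p f2 ->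
  quotient_at p (fun x => f1 x * f2 x).
Proof.
apply: (@quotient_at2 _ _ _ (fun a b => a * b) (fun a b c d => a * c)).
  by move=> g1 h1 g2 h2 x d1 d2 d3 d4; apply: (@differentiableM _ _ g1 g2).
by move=> a b c d b0 d0; exact: (@mulf_div R[i]).
Qed.

Lemma quotient_at_sum p (I : Type) (r : seq I) (Q : pred I) (F : I -> Cn R n -> Cx R) :
  (forall i, Q i -> quotient_at p (F i)) -> quotient_at p (fun x => \sum_(i <- r | Q i) F i x).
Proof.
move=> H; elim: r => [|i r IH].
  by under eq_fun do rewrite big_nil; exact: quotient_at_cst.
case Qi: (Q i); under eq_fun do rewrite big_cons Qi; last exact: IH.
by apply: quotient_atD => //; exact: H.
Qed.

Lemma quotient_at_prod p (I : Type) (r : seq I) (F : I -> Cn R n -> Cx R) :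
  (forall i, quotient_at p (F i)) -> quotient_at p (fun x => \prod_(i <- r) F i x).
Proof.
move=> H; elim: r => [|i r IH].
  by under eq_fun do rewrite big_nil; exact: quotient_at_cst.
by under eq_fun do rewrite big_cons; exact: quotient_atM.
Qed.

Lemma differentiable_coordB (i j : 'I_n) p :
  differentiable (fun x : Cn R n => (x ord0 i - x ord0 j : Cx R)) p.
Proof.
apply: (@differentiableB _ _ _ (fun x : Cn R n => (x ord0 i : Cx R)) (fun x : Cn R n => (x ord0 j : Cx R)));
  exact: differentiable_coord.
Qed.

Lemma quotient_at_pole p (i j : 'I_n) (w : Cx R) : i != j ->
  quotient_at p (fun x => (x ord0 i - x ord0 j - w) ^- 2).
Proof.
move=> ij; pose l x : Cx R := x ord0 i - x ord0 j - w.
have dl x : differentiable l x.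
  apply: (@differentiableB _ _ _ (fun x : Cn R n => (x ord0 i - x ord0 j : Cx R)) (fun _ => w)).
    exact: differentiable_coordB.
  exact: differentiable_cst.
exists setT, (fun _ => 1), (fun x => l x ^+ 2); split.
- by split => //; exact: openT.
- by move=> x _; exact: differentiable_cst.
- by move=> x _; exact: (@differentiableX _ _ l 1).
- move=> V oV [z Vz] _; have [lz|lz] := eqVneq (l z) 0; last by exists z; rewrite // expf_neq0.
  (* Moving along the i-th axis changes [l] by exactly [t], as [j] differs from [i]; so a zero of
     [l] can be left within [V]. *)
  pose s (t : Cx R) : Cn R n := z + t *: delta_mx ord0 i.
  have sV : \forall t \near (0 : Cx R), V (s t).
    have : s t @[t --> (0 : Cx R)] --> s 0.
      exact: cvgD (cvg_cst _) (@scalel_continuous _ _ _ _).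
    apply; rewrite /s scale0r addr0; exact: open_nbhs_nbhs.
  have [t [t0 Vt]] : exists t : Cx R, t != 0 /\ V (s t).
    have : \forall t \near (0 : Cx R)^', t != 0 /\ V (s t).
      near=> t; split; first by near: t; exact: nbhs_dnbhs_neq.
      by near: t; exact: (@nbhs_dnbhs _ (0 : Cx R)).
    by move=> /filter_ex; apply; exact: (@Proper_dnbhs_numFieldType R[i]).
  exists (s t) => //; rewrite expf_neq0 //.
  have -> : l (s t) = l z + t.
    have ji : j != i by rewrite eq_sym.
    by rewrite /l /s !mxE !eqxx (negbTE ji) mulr1 mulr0 addr0; ring.
  by rewrite lz add0r.
- by move=> z _ _; rewrite mul1r.
Unshelve. all: by end_near. Qed.

Lemma quotient_at_near p f f' U : open U -> U p -> (forall x, U x -> f x = f' x) ->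
  quotient_at p f' -> quotient_at p f.
Proof.
move=> oU Up E [V [g [h [[oV Vp] dg dh H Eh]]]].
exists (U `&` V), g, h; split.
- by split => //; exact: openI.
- by move=> x [_ /dg].
- by move=> x [_ /dh].
- by move=> W oW W0 WUV; apply: H => // z /WUV [].
- by move=> z [Uz Vz] hz; rewrite E // Eh.
Qed.

Lemma quotient_at_wp (tau : Cx R) (i j : 'I_n) p : 0 < complex.Im (tau : R[i]) -> i != j ->
  quotient_at p (fun x => wp tau (x ord0 i - x ord0 j)).
Proof.
move=> tau0 ij; pose d x : Cx R := x ord0 i - x ord0 j.
have r0 : 0 < nm (d p) + 1 by rewrite ltr_wpDl ?nm_ge0.
have [N0 [T [TE dT]]] := wp_tail tau0 r0.
pose U := d @^-1` [set z : Cx R | nm z < nm (d p) + 1].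
have oU : open U.
  apply: open_comp; first by move=> x _; exact: differentiable_continuous (differentiable_coordB i j x).
  rewrite (_ : [set _ | _] = ball (0 : Cx R) ((nm (d p) + 1)%:C%C : Cx R)).
    by apply: ball_open; rewrite ltcR.
  by apply/funext => z; apply/propext; rewrite -ball_normE /= sub0r normrN nmE ltcR.
have Up : U p by rewrite /U /= ltrDl.
suff : quotient_at p (fun x => d x ^- 2 + wp_partial tau (d x) N0 + T (d x)).
  by apply: (quotient_at_near oU Up) => x _; exact: TE.
apply: quotient_atD; last first.
  apply: (@quotient_at_holo _ _ U) => // x Ux.
  by apply: (@differentiable_comp _ _ _ _ d T) => //; [exact: differentiable_coordB|exact: dT].
apply: quotient_atD.
  by have := @quotient_at_pole p i j 0 ij; under eq_fun do rewrite subr0.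
rewrite /wp_partial; apply: quotient_at_sum => a _; apply: quotient_at_sum => b _.
case: (((a : nat) != N0) || ((b : nat) != N0)); last exact: quotient_at_cst.
by apply: quotient_atD; [exact: quotient_at_pole|exact: quotient_at_cst].
Qed.

(** [meromorphic] asks for connected neighbourhoods. A ball is the union of the segments from its
    centre, whose real parameter is embedded in the complex scalars. *)
Lemma ball_connected p (e : Cx R) : 0 < e -> connected (ball p e).
Proof.
move=> e0; pose gam x (s : Cx R) : Cn R n := p + s *: (x - p).
have creal : continuous (fun t : R => (t%:C%C : Cx R)).
  move=> t; apply/cvgrPdist_lt => d d0; have [dE rd0] := gtc0_real d0.
  near=> s; rewrite -rmorphB nmE nm_real dE ltcR; near: s.
  by apply: cvgr_dist_lt => //; exact: cvg_id.
have cgam x : continuous (gam x \o (fun t : R => (t%:C%C : Cx R))).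
  move=> t; apply: continuous_comp; first exact: creal.
  exact: cvgD (cvg_cst _) (@scalel_continuous _ _ _ _).
pose seg x := (gam x \o (fun t : R => (t%:C%C : Cx R))) @` `[0, 1]%classic.
have -> : ball p e = \bigcup_(x in ball p e) seg x.
  apply/seteqP; split => [x Bx|x [y By] [t]].
    exists x => //; exists 1; first by rewrite /= in_itv /= ler01 lexx.
    by rewrite /gam /= scale1r subrKC.
  rewrite /= in_itv /= => /andP[t0 t1] <-; move: By; rewrite -ball_normE /= => By.
  rewrite /gam opprD addrA subrr sub0r normrN normrZ -(distrC p y).
  apply: le_lt_trans By; rewrite ler_piMl // nmE nm_real lecR ger0_norm //.
apply: bigcup_connected.
  exists p => x Bx; exists 0; first by rewrite /= in_itv /= lexx ler01.
  by rewrite /gam /= scale0r addr0.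
move=> x Bx; apply: connected_continuous_connected; first exact: segment_connected.
exact: continuous_subspaceT.
Unshelve. all: by end_near. Qed.

Lemma quotient_meromorphic f : (forall p, quotient_at p f) -> meromorphic f.
Proof.
move=> H p; have [V [g [h [[oV Vp] dg dh dense_h E]]]] := H p.
have /nbhs_ballP[e /= e0 eV] : nbhs p V by exact: open_nbhs_nbhs.
have pe : ball p e p by exact: ballxx.
have oB : open (ball p e) by exact: ball_open.
exists (ball p e), g, h; split.
- by split => //; exact: ball_connected.
- by split => // x /eV /dg.
- by split => // x /eV /dh.
- by have [z ? ?] := dense_h _ oB (ex_intro _ p pe) eV; exists z.
- by move=> z /eV Vz hz; exact: E.
Qed.

End Quotients.

Section Even.
Variables (R : realType) (tau : Cx R).

(** The square is symmetric: reversing both indices exchanges w and -w. *)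
Lemma wp_partialN (z : Cx R) N : wp_partial tau (- z) N = wp_partial tau z N.
Proof.
rewrite /wp_partial (reindex_inj rev_ord_inj); apply: eq_bigr => a _.
rewrite (reindex_inj rev_ord_inj); apply: eq_bigr => b _ /=.
have revN (c : 'I_(N + N).+1) : ((N + N).+1 - c.+1 == N)%N = (c == N :> nat).
  by have := ltn_ord c; rewrite ltnS subSS => cN; lia.
have revR (c : 'I_(N + N).+1) : ((N + N).+1 - c.+1)%N%:R - N%:R = - (c%:R - N%:R) :> Cx R.
  have cN : (c <= N + N)%N by rewrite -ltnS.
  by rewrite subSS natrB // natrD opprB addrAC addrK.
rewrite !revN !revR; case: ifP => // _.
by rewrite mulNr -opprD -opprD sqrrN sqrrN.
Qed.

Lemma wpN (z : Cx R) : wp tau (- z) = wp tau z.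
Proof.
by rewrite /wp sqrrN; congr (_ + limn _); apply/funext => N; exact: wp_partialN.
Qed.

Lemma phi_hafnian n (S : {set 'I_n}) :
  phi tau S = (fun x => hafnian (fun i j => wp tau (x ord0 i - x ord0 j)) S).
Proof. by []. Qed.
End Even.

(** * The morphism [iota] on local quotients *)

Section MeroClosure.
Variables (R : realType) (n : nat) (tau : Cx R) (A : pzRingType) (iota : (Cn R n -> Cx R) -> A).
Hypothesis tau0 : 0 < complex.Im (tau : R[i]).
Hypothesis iotaD : forall f g, meromorphic f -> meromorphic g ->
  iota (fun x => f x + g x) = iota f + iota g.
Hypothesis iotaM : forall f g, meromorphic f -> meromorphic g ->
  iota (fun x => f x * g x) = iota f * iota g.

Definition quotient f := forall p, @quotient_at R n p f.

Lemma quotient_phi (S : {set 'I_n}) : quotient (phi tau S).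
Proof.
move=> p; apply: quotient_at_sum => ab /and4P[/forallP ab12 _ _ _].
apply: quotient_at_prod => t; apply: quotient_at_wp => //.
by apply/eqP => E; have := ab12 t; rewrite E ltnn.
Qed.

Lemma quotient_wp i j : i != j -> quotient (fun x => wp tau (x ord0 i - x ord0 j)).
Proof. by move=> ij p; apply: quotient_at_wp. Qed.

Lemma quotient_cst (a : Cx R) : quotient (fun _ => a).
Proof. by move=> p; apply: quotient_at_cst. Qed.

Lemma iota0 : iota (fun _ => 0) = 0.
Proof.
have m0 := quotient_meromorphic (quotient_cst 0).
apply: (addrI (iota (fun _ => 0))); rewrite addr0 -iotaD //; congr iota.
by apply/funext => x; rewrite addr0.
Qed.

Lemma iotaB f g : quotient f -> quotient g -> iota (fun x => f x - g x) = iota f - iota g.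
Proof.
move=> qf qg.
have qfg : quotient (fun x => f x - g x).
  move=> p; rewrite (_ : (fun x => _) = (fun x => f x + (-1) * g x)); last first.
    by apply/funext => x; rewrite mulN1r.
  by apply: quotient_atD => //; apply: quotient_atM => //; exact: quotient_at_cst.
apply/eqP; rewrite eq_sym subr_eq -iotaD; [|exact: quotient_meromorphic..].
by apply/eqP; congr iota; apply/funext => x; rewrite subrK.
Qed.

Lemma iota_comm f g : quotient f -> quotient g -> iota f * iota g = iota g * iota f.
Proof.
move=> /quotient_meromorphic mf /quotient_meromorphic mg; rewrite -!iotaM //; congr iota.
by apply/funext => x; rewrite mulrC.
Qed.

Lemma iota_sum (I : Type) (r : seq I) (Q : pred I) (F : I -> Cn R n -> Cx R) :
  (forall i, Q i -> quotient (F i)) ->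
  iota (fun x => \sum_(i <- r | Q i) F i x) = \sum_(i <- r | Q i) iota (F i).
Proof.
move=> qF; elim: r => [|i r IH].
  by under eq_fun do rewrite big_nil; rewrite big_nil iota0.
rewrite big_cons; case Qi: (Q i); under eq_fun do rewrite big_cons Qi; last by [].
rewrite -IH iotaD //; apply: quotient_meromorphic; first exact: qF.
by move=> p; apply: quotient_at_sum => k Qk; apply: qF.
Qed.
End MeroClosure.

Unset Implicit Arguments. Set Strict Implicit.

(* The algebra A of the paper is the C-algebra presented by M and the symbols
   [ij] subject to (i)-(iv); an identity holds in A iff it holds in every ring
   [A] equipped with a ring morphism [iota : M -> A] and elements [br i j]
   satisfying (i)-(iv) (universal property of the presentation).  M is the
   field of meromorphic functions on C^n, represented by functions
   C^n -> C satisfying [meromorphic], modulo [mero_eq]. *)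
Theorem theorem3p1 (R : realType) (n : nat) (tau : Cx R) (lam : 'I_n -> Cx R)
    (A : pzRingType) (iota : (Cn R n -> Cx R) -> A) (br : 'I_n -> 'I_n -> A) :
  (2 <= n)%N ->
  0 < complex.Im (tau : R[i]) ->
  (forall i j : 'I_n, i != j -> ~ in_lattice tau (lam i - lam j)) ->
  (* iota is a ring morphism from M to A *)
  (forall f g, meromorphic f -> meromorphic g -> mero_eq f g -> iota f = iota g) ->
  (forall f g, meromorphic f -> meromorphic g ->
     iota (fun x => f x + g x) = iota f + iota g) ->
  (forall f g, meromorphic f -> meromorphic g ->
     iota (fun x => f x * g x) = iota f * iota g) ->
  iota (fun _ => 1) = 1 ->
  (* [ji] = -[ij] *)
  (forall i j, i != j -> br j i = - br i j) ->
  (* (i) *)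
  (forall i j, i != j ->
     br i j * br i j = iota (fun x => wp tau (lam i - lam j) - wp tau (x ord0 i - x ord0 j))) ->
  (* (ii) *)
  (forall i j k l, i != j -> k != l -> [disjoint [set i; j] & [set k; l]] ->
     br i j * br k l = br k l * br i j) ->
  (* (iii) *)
  (forall i j k, i != j -> j != k -> k != i ->
     br i j * br j k + br j k * br k i + br k i * br i j = 0) ->
  (* (iv) *)
  (forall i j f, i != j -> meromorphic f ->
     br i j * iota f = iota (swapf i j f) * br i j) ->
  forall (I : {set 'I_n}) (k : nat),
    Eset (dunkl br) (fun i j => iota (fun _ => wp tau (lam i - lam j))) I k
    = \sum_(l < (k %/ 2).+1)
        \sum_(I0 : {set 'I_n} | (I0 \subset I) && (#|I0| == 2 * l)%N)
          iota (phi tau I0) *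
          \sum_(ab : {ffun 'I_(k - 2 * l) -> 'I_n * 'I_n} | star_seq I I0 ab)
             \prod_(t < k - 2 * l) br (ab t).1 (ab t).2.
Proof.
move=> _ tau0 _ _ iotaD iotaM iota1 brN br2 brC br3 br4 I k.
have qW i j := @quotient_wp R n tau tau0 i j.
have qc i j := @quotient_cst R n (wp tau (lam i - lam j)).
have qphi := @quotient_phi R n tau tau0.
pose W (x : Cn R n) i j := wp tau (x ord0 i - x ord0 j).
have WC x i j : W x i j = W x j i by rewrite /W -wpN opprB.
(* [P i j] is the image of x |-> wp(x_i - x_j); its symmetry and the expansion of [phi] are checked
   at each point x and carried over by [iota]. *)
apply: (@Eset_pieri n A br (fun i j => iota (fun x => W x i j))).
- exact: brN.
- by move=> i j ij; rewrite br2 // (iotaB iotaD) //; exact: qW.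
- exact: brC.
- exact: br3.
- move=> i j a b ij ab; rewrite br4 //; last exact/quotient_meromorphic/qW.
  by congr (iota _ * _); apply/funext => x; rewrite /swapf /W !mxE.
- by move=> i j a b ij; rewrite br4 //; apply: quotient_meromorphic; exact: quotient_cst.
- by move=> i j; congr iota; apply/funext => x; apply: WC.
- by rewrite -iota1; congr iota; apply/funext => x; rewrite phi_hafnian hafnian0.
- move=> S oS; rewrite -(iota0 iotaD); congr iota; apply/funext => x.
  by rewrite phi_hafnian hafnian_odd.
- move=> j S jS.
  have -> : phi tau (j |: S) = (fun x => \sum_(i in S) W x i j * phi tau (S :\ i) x).
    by apply/funext => x; exact: (hafnianU1 (WC x) jS).
  have neq i : i \in S -> i != j by move=> iS; apply: contraNneq jS => <-.
  rewrite (iota_sum iotaD) => [|i iS p]; last first.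
    by apply: quotient_atM; [apply/qW/neq|apply: qphi].
  apply: eq_bigr => i iS; rewrite iotaM //; apply: quotient_meromorphic.
    by apply: qW; apply: neq.
  exact: qphi.
- by move=> i j S ij; apply: (iota_comm iotaM); [exact: qW|exact: qphi].
- by move=> i j S; apply: (iota_comm iotaM); [exact: qc|exact: qphi].
Qed.
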